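(* Let $L,\lambda,\mu,c>0$, $\Omega=(-L,L)$, $f(x)=\lambda x$ and $\alpha(x)=\mu|x|+c$ for $x\in\Omega$. Then the solution $u$ of $$\min_{u\in BV(\Omega)}\ \frac12\int_\Omega (f-u)^2\,dx+\int_\Omega \alpha(x)\,d|Du|$$ is given (up to Lebesgue-null sets) by the following formulae. (1) If $\mu L+c<\frac{\lambda L^2}{2}$, then, with $x_{\mu,c}=L-\frac{\sqrt{2\lambda\mu L+2\lambda c}}{\lambda}$, $$u(x)=\begin{cases}-\lambda x_{\mu,c}-\mu,& x\in(-L,-x_{\mu,c}],\\ \lambda x-\mu,& x\in(-x_{\mu,c},0),\\ \lambda x+\mu,& x\in[0,x_{\mu,c}),\\ \lambda x_{\mu,c}+\mu,& x\in[x_{\mu,c},L).\end{cases}$$ (2) If $\mu L+c\ge\frac{\lambda L^2}{2}$ and $c<\frac{\lambda L^2}{2}$, then $$u(x)=\begin{cases}-\frac{\lambda L}{2}+\frac{c}{L},& x\in(-L,0),\\ \frac{\lambda L}{2}-\frac{c}{L},& x\in[0,L).\end{cases}$$ (3) If $c\ge\frac{\lambda L^2}{2}$, then $u(x)=0$ for $x\in(-L,L)$.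
   Context: For $u\in BV(\Omega)$, $|Du|$ is the total variation measure of the distributional derivative $Du$. The minimisation problem has a unique solution. *)

(* Defs.v *)
From mathcomp Require Import all_boot all_order all_algebra.
From mathcomp Require Import all_classical all_reals all_analysis.

Set Implicit Arguments.
Unset Strict Implicit.
Unset Printing Implicit Defensive.

Import Order.TTheory GRing.Theory Num.Theory.
Import numFieldNormedType.Exports.

Local Open Scope classical_set_scope.
Local Open Scope ring_scope.

Section signed_measures.
Context (R : realType).
Local Notation mR := (measurableTypeR R).
Implicit Type nu : {charge set mR -> \bar R}.

Lemma hahn_exists nu :
  exists PN : set mR * set mR, hahn_decomposition nu PN.1 PN.2.
Proof. by have [P [N PN]] := Hahn_decomposition nu; exists (P, N). Qed.

(* Hahn decompositions are unique up to nu-null sets, so the Jordan parts and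
   the variation below do not depend on the one chosen here. *)
Definition hahn nu := projT2 (cid (hahn_exists nu)).

Definition variation_measure nu : {measure set mR -> \bar R} :=
  charge_variation (hahn nu).

Definition charge_integral nu (D : set R) (g : R -> R) : R :=
  Rintegral (jordan_pos (hahn nu)) D g - Rintegral (jordan_neg (hahn nu)) D g.

End signed_measures.

Section bounded_variation_functions.
Context (R : realType).
Local Notation mR := (measurableTypeR R).
Implicit Types (Omega : set R) (u phi : R -> R).
Implicit Type nu : {charge set mR -> \bar R}.

(* the space C_c^oo(Omega) *)
Definition test_function Omega phi :=
  [/\ forall n x, derivable (derive1n n phi) x 1,
      compact (closure [set x | phi x != 0])
    & closure [set x | phi x != 0] `<=` Omega].

(* A finite signed Radon measure on Omega is encoded as a charge on the Borel
   sets of the line that vanishes on the Borel sets disjoint from Omega. *)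
Definition is_distributional_derivative Omega u nu :=
  (forall A : set mR, measurable A -> A `&` Omega = set0 -> nu A = 0%E) /\
  (forall phi, test_function Omega phi ->
    Rintegral (@lebesgue_measure R) Omega (fun x => u x * derive1 phi x)
      = - charge_integral nu Omega phi).

(* Elements of L^1(Omega) are represented by functions on the whole line that
   are Borel measurable on Omega; their values outside Omega are irrelevant. *)
Definition BV Omega u :=
  (@lebesgue_measure R).-integrable Omega (EFin \o u) /\
  exists nu, is_distributional_derivative Omega u nu.

(* Outside BV the value is the zero charge, by convention. *)
Definition Du Omega u : {charge set mR -> \bar R} :=
  if pselect (exists nu, is_distributional_derivative Omega u nu) is left h
  then projT1 (cid h) else czero.

Definition weighted_TV_energy Omega (f alpha u : R -> R) : \bar R :=
  ((2^-1)%:E * (\int[@lebesgue_measure R]_(x in Omega) ((f x - u x) ^+ 2)%:E)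
   + \int[variation_measure (Du Omega u)]_(x in Omega) (alpha x)%:E)%E.

Definition is_solution Omega (f alpha u : R -> R) :=
  BV Omega u /\
  forall w, BV Omega w ->
    (weighted_TV_energy Omega f alpha u <= weighted_TV_energy Omega f alpha w)%E.

Definition is_the_solution Omega (f alpha u0 : R -> R) :=
  is_solution Omega f alpha u0 /\
  forall u, is_solution Omega f alpha u ->
    {ae @lebesgue_measure R, forall x, Omega x -> u x = u0 x}.

End bounded_variation_functions.

(* Main.v *)
(* The proof is by calibration.  In the three regimes the claimed minimizer is
   u = f + h for one family of odd functions h, depending on two parameters: half
   the height K of the jump of u at 0, and X such that u has slope lambda on
   (-X, X) minus the origin and is constant on each side beyond.  The parameters
   are (mu, x_{mu,c}), (lambda L / 2 - c / L, 0) and (0, 0) respectively.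
   The primitive V of h that vanishes at both ends of Omega satisfies
   |V| <= alpha, with equality V = alpha on the support of the nonnegative measure
   Du.  Integrating by parts, for every w in BV(Omega),
     int h w = - int V dDw >= - int alpha d|Dw|,  with equality for w = u,
   and expanding the square f - w = (u - w) - h gives
     E(w) >= E(u) + 1/2 int (w - u)^2,
   whence minimality and uniqueness.
   The integration by parts is not immediate since V is neither smooth nor
   compactly supported: V is approximated by the primitives of odd smooth functions
   with compact support, built from exp(-1/x).  The same functions show that Du is
   determined by its action on test functions, so that the derivative of u selected
   by the definition of the energy is the expected one. *)

Require Import Defs.
From mathcomp Require Import all_boot all_order all_algebra.
From mathcomp Require Import all_classical all_reals all_analysis.
From mathcomp Require Import measurable_realfun.
From mathcomp Require Import ring lra.

Set Implicit Arguments.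
Unset Strict Implicit.
Unset Printing Implicit Defensive.

Import Order.TTheory GRing.Theory Num.Theory.
Import numFieldNormedType.Exports.

Local Open Scope classical_set_scope.
Local Open Scope ring_scope.

(** * Smooth functions *)

Section smooth_functions.
Context {R : realType}.
Implicit Types (f g : R -> R) (x y p q : R).

(** Derivatives are carried as witnesses rather than through [derive1n], so that sums, products and
    affine substitutions go by induction on the order; [smooth_derivable] converts back. *)
Fixpoint differentiable_times (n : nat) (f : R -> R) : Prop :=
  if n is m.+1 then
    exists2 df, forall x, is_derive x 1 f (df x) & differentiable_times m df
  else True.

Definition smooth f := forall n, differentiable_times n f.

Lemma differentiable_timesW n f :
  differentiable_times n.+1 f -> differentiable_times n f.
Proof.
by elim: n f => // n IH f [df dfP /IH dfn]; exists df.
Qed.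

Lemma differentiable_timesD n f g :
  differentiable_times n f -> differentiable_times n g ->
  differentiable_times n (f \+ g).
Proof.
elim: n f g => // n IH f g [df dfP ndf] [dg dgP ndg].
by exists (df \+ dg); [move=> x; exact: is_deriveD|exact: IH].
Qed.

Lemma differentiable_timesM n f g :
  differentiable_times n f -> differentiable_times n g ->
  differentiable_times n (f \* g).
Proof.
elim: n f g => // n IH f g nf ng.
have f' := differentiable_timesW nf; have g' := differentiable_timesW ng.
case: nf ng => [df dfP ndf] [dg dgP ndg].
exists ((f \* dg) \+ (g \* df)); first by move=> x; exact: is_deriveM.
by apply: differentiable_timesD; exact: IH.
Qed.

Lemma smooth_cst (c : R) : smooth (fun=> c).
Proof.
move=> n; elim: n c => // n IH c.
by exists (fun=> 0) => // x; exact: is_derive_cst.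
Qed.

Lemma smoothD f g : smooth f -> smooth g -> smooth (f \+ g).
Proof. by move=> sf sg n; exact: differentiable_timesD. Qed.

Lemma smoothM f g : smooth f -> smooth g -> smooth (f \* g).
Proof. by move=> sf sg n; exact: differentiable_timesM. Qed.

Lemma is_derive_affine p q x : is_derive x 1 (fun x => p * x + q) p.
Proof.
have -> : (fun x => p * x + q) = (p \*: id) + cst q by [].
by apply: is_derive_eq; rewrite addr0 /GRing.scale/= mulr1.
Qed.

Lemma smooth_affine p q : smooth (fun x => p * x + q).
Proof.
case=> // n; exists (fun=> p); last exact: smooth_cst.
by move=> x; exact: is_derive_affine.
Qed.

Lemma smooth_comp_affine p q f : smooth f -> smooth (fun x => f (p * x + q)).
Proof.
move=> + n; elim: n f => // n IH f sf.
have [df dfP _] := sf 1%N.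
(* The witnesses of [sf] at all orders are the same first derivative, so [df] inherits every
   order. *)
have sdf : smooth df.
  move=> m; have [df' dfP' mdf'] := sf m.+1.
  rewrite (_ : df = df')//; apply/funext => x.
  by rewrite -(@derive_val _ _ _ _ _ _ _ (dfP x)) -(@derive_val _ _ _ _ _ _ _ (dfP' x)).
exists (fun x => df (p * x + q) * p); last first.
  by apply: differentiable_timesM; [exact: IH|exact: smooth_cst].
move=> x; apply: (@is_derive1_comp _ f (fun x => p * x + q)).
exact: is_derive_affine.
Qed.

Lemma smooth_antiderivative f g :
  (forall x, is_derive x 1 f (g x)) -> smooth g -> smooth f.
Proof. by move=> fg sg [//|n]; exists g. Qed.

Lemma smooth_derivable f n x : smooth f -> derivable (derive1n n f) x 1.
Proof.
move=> /(_ n.+1); elim: n f => [|n IH] f [df dfP ndf]; first exact: ex_derive.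
rewrite /derive1n iterSr -/(derive1n n _).
suff -> : derive1 f = df by exact: IH.
by apply/funext => y; rewrite derive1E derive_val.
Qed.

Lemma smooth_continuous f : smooth f -> continuous f.
Proof.
move=> /(_ 1%N)[df dfP _] x.
by apply/differentiable_continuous/derivable1_diffP; exact: ex_derive.
Qed.

End smooth_functions.

(** * Flat functions built from exp(-1/x) *)

Section flat_function.
Context {R : realType}.
Implicit Types (x y : R) (k n : nat).

(** Thanks to the powers of 1/x, the derivative of a member of the family is a linear combination of
    members. *)
Definition flat k x : R := if 0 < x then x^-1 ^+ k * expR (- x^-1) else 0.

Lemma flat_le0 k x : x <= 0 -> flat k x = 0.
Proof. by rewrite /flat => x0; rewrite ltNge x0. Qed.

Lemma flat_ge0 k x : 0 <= flat k x.
Proof.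
rewrite /flat; case: ifPn => // x0.
by rewrite mulr_ge0 ?expR_ge0// exprn_ge0// invr_ge0 ltW.
Qed.

Lemma flat0_le1 x : flat 0 x <= 1.
Proof.
rewrite /flat; case: ifPn => // x0.
by rewrite expr0 mul1r expR_le1 oppr_le0 invr_ge0 ltW.
Qed.

(* [expR t >= (t / (k+1)) ^ (k+1)] at [t = 1 / x]. *)
Lemma flat_linear_bound k x : 0 <= x -> flat k x <= k.+1%:R ^+ k.+1 * x.
Proof.
rewrite le_eqVlt => /predU1P[<-|x0]; first by rewrite flat_le0// mulr0.
rewrite /flat x0; set t := x^-1; have t0 : 0 < t by rewrite invr_gt0.
have -> : x = t^-1 by rewrite invrK.
rewrite expRN ler_pdivrMr ?expR_gt0//.
have kt : t = k.+1%:R * (t / k.+1%:R) by rewrite mulrC divfK// pnatr_eq0.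
have -> : expR t = expR (t / k.+1%:R) ^+ k.+1 by rewrite {1}kt expRM_natl.
apply: (@le_trans _ _ (k.+1%:R ^+ k.+1 / t * (t / k.+1%:R) ^+ k.+1)).
  rewrite expr_div_n [t ^+ k.+1]exprS.
  have N0 : k.+1%:R ^+ k.+1 != 0 :> R by rewrite expf_neq0 ?pnatr_eq0.
  by rewrite le_eqVlt; apply/orP; left; apply/eqP; field; rewrite N0 gt_eqF.
rewrite ler_wpM2l//; first by rewrite divr_ge0// ltW.
rewrite lerXn2r ?nnegrE ?expR_ge0 ?divr_ge0 ?ltW//.
by rewrite (lt_le_trans _ (expR_ge1Dx _))// ltrDr.
Qed.

(** Left of 0 the function is locally zero, and right of 0 this is the product rule. At 0 the
    difference quotient of [flat k] is [flat k.+1], which tends to 0 by [flat_linear_bound]. *)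
Lemma is_derive_flat k x :
  is_derive x 1 (flat k) (flat k.+2 x - k%:R * flat k.+1 x).
Proof.
have [x0|x0|->] := ltrgtP x 0.
- apply: (@near_eq_is_derive _ _ _ (cst 0)).
    near=> y; rewrite flat_le0//.
    by near: y; apply: filterS (lt_nbhsl x0) => y /ltW.
  by rewrite !flat_le0 ?ltW// mulr0 subr0; exact: is_derive_cst.
- apply: (@near_eq_is_derive _ _ _
      ((fun y => y^-1) ^+ k * (expR \o - (fun y => y^-1)))).
    near=> y; rewrite /flat ifT//.
      by rewrite fctE exprfctE.
    by near: y; exact: lt_nbhsr.
  have dV : is_derive x 1 (fun y : R => y^-1) (- x ^- 2 *: 1).
    by apply: is_deriveV; rewrite ?gt_eqF.
  apply: is_derive_eq.
  rewrite /flat x0 /GRing.scale/= exprfctE -[(- _) x]/(- x^-1) -exprVn.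
  by case: k => [|k] /=; rewrite ?mul0r ?mulr0 ?exprS; ring.
- rewrite !flat_le0// mulr0 subr0.
  suff d0 : (fun h => h^-1 *: ((flat k \o shift 0) (h *: 1) - flat k 0)) @ 0^'
      --> (0 : R).
    by apply: DeriveDef; [apply/cvg_ex; exists 0|exact/cvg_lim].
  apply/cvgrPdist_le => e e0; near=> h.
  have h0 : h != 0 by near: h; exact: nbhs_dnbhs_neq.
  have {h0} -> : h^-1 *: ((flat k \o shift 0) (h *: 1) - flat k 0) = flat k.+1 h.
    rewrite /= addr0 (flat_le0 k (lexx 0)) subr0 /GRing.scale/= mulr1 /flat.
    by case: ifPn; rewrite ?mulr0// exprS mulrA.
  rewrite sub0r normrN ger0_norm ?flat_ge0//.
  have [h0|h0] := leP h 0; first by rewrite flat_le0// ltW.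
  rewrite (le_trans (flat_linear_bound _ (ltW h0)))// mulrC -ler_pdivlMr//.
  rewrite (le_trans (ler_norm _))//; near: h; apply: dnbhs0_le.
  by rewrite divr_gt0// exprn_gt0.
Unshelve. all: by end_near. Qed.

Lemma smooth_flat k : smooth (flat k).
Proof.
move=> n; elim: n k => // n IH k.
exists (flat k.+2 \+ ((fun=> - k%:R) \* flat k.+1)).
  by move=> x; apply: is_derive_eq (is_derive_flat k x) _ => /=; rewrite mulNr.
apply: differentiable_timesD => //; apply: differentiable_timesM => //.
exact: smooth_cst.
Qed.

Lemma cvg_flat0_scaled x q : 0 < x ->
  flat 0 (n.+1%:R * x + q) @[n --> \oo] --> (1 : R).
Proof.
suff h p : 0 < x -> flat 0 (n%:R * x + p) @[n --> \oo] --> (1 : R).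
  move=> /(h (x + q)) hx.
  by under eq_cvg => n do rewrite -natr1 mulrDl mul1r -addrA.
move: p => {}q; move=> x0; apply/cvgrPdist_le => e e0; near=> n.
(* Since 1 - exp(-1/y) <= 1/y, it is enough that y >= [e^-1]. *)
have ny : e^-1 <= n%:R * x + q.
  by rewrite -lerBlDr -ler_pdivrMr//; near: n; exact: nbhs_infty_ger.
have y0 : 0 < n%:R * x + q by rewrite (lt_le_trans _ ny)// invr_gt0.
rewrite ger0_norm ?subr_ge0 ?flat0_le1// /flat y0 expr0 mul1r.
rewrite lerBlDr -lerBlDl (le_trans _ (expR_ge1Dx _))// lerD2l lerN2.
by rewrite -[leRHS]invrK lef_pV2// posrE invr_gt0.
Unshelve. all: by end_near. Qed.

End flat_function.

(** * Integration of real-valued functions *)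

Section integration_tools.
Context d (T : measurableType d) (R : realType).
Variable mu : {measure set T -> \bar R}.
Implicit Types (D : set T) (f g : T -> R).

Lemma cvg_Rintegral D (f_ : nat -> T -> R) f g : measurable D ->
  (forall n, measurable_fun D (f_ n)) -> measurable_fun D f ->
  {ae mu, forall x, D x -> f_ n x @[n --> \oo] --> f x} ->
  mu.-integrable D (EFin \o g) ->
  (forall n x, D x -> `|f_ n x| <= g x) ->
  Rintegral mu D (f_ n) @[n --> \oo] --> Rintegral mu D f.
Proof.
move=> mD mf_ mf f_f ig f_g.
have f_f' : {ae mu, forall x, D x ->
    (EFin \o f_ n) x @[n --> \oo] --> (EFin \o f) x}.
  by apply: filterS f_f => x /[apply] fx; apply: cvg_EFin => //; exact: nearW.
have f_g' : {ae mu, forall x n, D x -> (`|(EFin \o f_ n) x| <= (EFin \o g) x)%E}.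
  by apply: aeW => x n Dx; rewrite lee_fin f_g.
have [if_ _ +] := dominated_convergence mD
  (fun n => (measurable_EFinP _ _).2 (mf_ n))
  ((measurable_EFinP _ _).2 mf) f_f' ig f_g'.
rewrite /= -[X in _ --> X]fineK; last exact: integrable_fin_num.
by move/fine_cvg.
Qed.

Lemma finite_bounded_integrable D f (M : R) : measurable D ->
  (mu D < +oo)%E -> measurable_fun D f -> (forall x, D x -> `|f x| <= M) ->
  mu.-integrable D (EFin \o f).
Proof.
move=> mD Dfin mf fM; apply: measurable_bounded_integrable => //.
exists M; split; first exact: num_real.
by move=> N MN x Dx /=; rewrite (le_trans (fM _ Dx))// ltW.
Qed.

End integration_tools.

(** * Test functions: cutoffs and primitives *)

Section test_functions.
Context {R : realType}.
Local Notation leb := (@lebesgue_measure R).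
Implicit Types (a b x : R) (n : nat) (phi h : R -> R).

Lemma smooth_test_function (Omega : set R) a b phi : smooth phi ->
  (forall x, phi x != 0 -> a <= x <= b) -> `[a, b]%classic `<=` Omega ->
  test_function Omega phi.
Proof.
move=> sphi suppphi abOmega.
have clab : closure [set x | phi x != 0] `<=` `[a, b]%classic.
  rewrite [X in _ `<=` X](iffLR (closure_id _)); last exact: interval_closed.
  by apply: closureS => x /= /suppphi; rewrite in_itv.
split; last exact: subset_trans clab abOmega.
- by move=> n x; exact: smooth_derivable.
- apply: (subclosed_compact _ (@segment_compact R a b) clab).
  exact: closed_closure.
Qed.

(** The two arguments are (n+1)(x - a) - 1 and (n+1)(b - x) - 1; the shift by 1 keeps the support at
    distance at least 1/(n+1) from both ends, hence compact inside the open interval. *)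
Definition cutoff a b n x : R :=
  flat 0 (n.+1%:R * x + (- n.+1%:R * a - 1)) *
  flat 0 (- n.+1%:R * x + (n.+1%:R * b - 1)).

Lemma smooth_cutoff a b n : smooth (cutoff a b n).
Proof.
by apply: smoothM; apply: smooth_comp_affine; exact: smooth_flat.
Qed.

Lemma cutoff_ge0 a b n x : 0 <= cutoff a b n x.
Proof. by rewrite mulr_ge0// flat_ge0. Qed.

Lemma cutoff_le1 a b n x : cutoff a b n x <= 1.
Proof. by rewrite mulr_ile1// ?flat_ge0// flat0_le1. Qed.

Lemma cutoff_support a b n x :
  cutoff a b n x != 0 -> a + n.+1%:R^-1 <= x <= b - n.+1%:R^-1.
Proof.
rewrite mulf_eq0 negb_or => /andP[xa xb].
have n0 : 0 < n.+1%:R :> R by rewrite ltr0n.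
have [ha|ha] := leP (n.+1%:R * x + (- n.+1%:R * a - 1)) 0.
  by rewrite flat_le0 ?eqxx in xa.
have [hb|hb] := leP (- n.+1%:R * x + (n.+1%:R * b - 1)) 0.
  by rewrite flat_le0 ?eqxx in xb.
have e : n.+1%:R * n.+1%:R^-1 = 1 :> R by rewrite mulfV ?gt_eqF.
by apply/andP; split; rewrite -(ler_pM2l n0) mulrDr ?mulrN e; lra.
Qed.

Lemma cvg_cutoff a b x : cutoff a b n x @[n --> \oo] --> (\1_(`]a, b[) x : R).
Proof.
have [xab|] := boolP (x \in `]a, b[).
  move: (xab); rewrite in_itv/= => /andP[ax xb]; rewrite indicE mem_set//.
  rewrite -[1%:R]mulr1; apply: cvgM.
    have e n : n.+1%:R * x + (- n.+1%:R * a - 1) = n.+1%:R * (x - a) - 1 by ring.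
    under eq_cvg => n do rewrite e.
    by apply: cvg_flat0_scaled; rewrite subr_gt0.
  have e n : - n.+1%:R * x + (n.+1%:R * b - 1) = n.+1%:R * (b - x) - 1 by ring.
  under eq_cvg => n do rewrite e.
  by apply: cvg_flat0_scaled; rewrite subr_gt0.
move=> xab; rewrite indicE memNset ?(negbTE xab)//=; last exact/negP.
rewrite (_ : (fun n => cutoff a b n x) = cst 0); first exact: cvg_cst.
apply/funext => n; apply/eqP; apply: contraNT xab => /cutoff_support /andP[xa xb].
rewrite in_itv/= (lt_le_trans _ xa) ?ltrDl ?invr_gt0//=.
by rewrite (le_lt_trans xb)// gtrDl oppr_lt0 invr_gt0.
Qed.

Lemma test_function_cutoff (Omega : set R) a b n :
  `]a, b[%classic `<=` Omega -> test_function Omega (cutoff a b n).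
Proof.
move=> abOmega.
apply: (@smooth_test_function _ (a + n.+1%:R^-1) (b - n.+1%:R^-1)).
- exact: smooth_cutoff.
- exact: cutoff_support.
- apply: subset_trans abOmega => x /=; rewrite !in_itv/= => /andP[xa xb].
  rewrite (lt_le_trans _ xa) ?ltrDl ?invr_gt0//=.
  by rewrite (le_lt_trans xb)// gtrDl oppr_lt0 invr_gt0.
Qed.

(** A primitive started at the far left vanishes beyond the support on the right only if the total
    integral is zero. Oddness of [h] ensures this by making [F] even. *)
Lemma odd_test_function_antiderivative (L a : R) h : 0 < a -> a < L ->
  smooth h -> (forall x, h x != 0 -> - a <= x <= a) ->
  (forall x, h (- x) = - h x) ->
  let F x := Rintegral leb `]-oo, x] h in
  test_function `]- L, L[ F /\ forall x, derive1 F x = h x.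
Proof.
move=> a0 aL sh supph oddh F.
have ih x : leb.-integrable `]-oo, x]%classic (EFin \o h).
  apply: (@integrableS _ _ _ _ setT) => //.
  have : leb.-integrable `[- a, a]%classic (EFin \o h).
    apply: continuous_compact_integrable; first exact: segment_compact.
    exact/continuous_subspaceT/smooth_continuous.
  move/integrable_mkcond => /(_ (measurable_itv _)); congr (leb.-integrable _ _).
  apply/funext => y; rewrite patchE; case: ifPn => // /negP ya.
  apply/esym; congr EFin; apply/eqP/negPn/negP => /supph hy; apply: ya.
  by rewrite inE/= in_itv.
have Fd x : is_derive x 1 F (h x).
  have [|||Fd F'] := @continuous_FTC1 R h -oo%O x (x + 1) _ (ih _).
  - by rewrite ltrDl.
  - exact: ltNyr.
  - exact: smooth_continuous.
  by apply: DeriveDef => //; rewrite -derive1E.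
have F_even x : F (- x) = F x.
  (* The derivative is [h y + h (- y)], and the function itself vanishes at 0. *)
  have dG y : is_derive y (1 : R) (F - (F \o -%R)) 0.
    have dF : is_derive y 1 (F \o -%R) (h (- y) * -1).
      by apply: is_derive1_comp; exact: Fd.
    by apply: is_derive_eq; rewrite oddh; ring.
  have /eqP := is_derive_0_is_cst x 0 dG.
  by rewrite !fctE/= oppr0 subrr subr_eq0 => /eqP.
have F0 x : x < - a -> F x = 0.
  move=> xa; rewrite /F (@eq_Rintegral _ _ _ _ _ (cst 0)); last first.
    move=> y; rewrite inE/= in_itv/= => yx; apply/eqP/negPn/negP => /supph.
    by rewrite leNgt (le_lt_trans yx).
  by rewrite Rintegral_cst// mul0r.
have sF : smooth F by exact: smooth_antiderivative Fd sh.
split; last by move=> x; rewrite derive1E derive_val.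
apply: (@smooth_test_function _ (- a) a) => //.
  move=> x Fx; apply/andP; split; rewrite leNgt; apply/negP => xa.
    by rewrite F0 ?eqxx in Fx.
  by rewrite -F_even F0 ?eqxx ?ltrN2 in Fx.
move=> x /=; rewrite !in_itv/= => /andP[xa ax].
by rewrite (lt_le_trans _ xa) ?ltrN2//= (le_lt_trans ax).
Qed.

End test_functions.

(** * Distributional derivatives *)

Section charge_integral_theory.
Context {R : realType}.
Local Notation mR := (measurableTypeR R).
Local Notation leb := (@lebesgue_measure R).
Implicit Types (nu : {charge set mR -> \bar R}) (D : set R) (f : R -> R).

Lemma cvg_charge_integral nu D (f_ : nat -> R -> R) f (M : R) : measurable D ->
  (forall n, measurable_fun D (f_ n)) ->
  (forall n x, D x -> `|f_ n x| <= M) ->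
  (forall x, D x -> f_ n x @[n --> \oo] --> f x) ->
  charge_integral nu D (f_ n) @[n --> \oo] --> charge_integral nu D f.
Proof.
move=> mD mf_ fM f_f.
have mf : measurable_fun D f by exact: measurable_fun_cvg f_f.
by apply: cvgB; apply: (cvg_Rintegral (g := cst M)) => //;
  try (exact: finite_measure_integrable_cst); exact: aeW.
Qed.

Lemma test_function_continuous (Omega : set R) phi :
  test_function Omega phi -> continuous phi /\ continuous (derive1 phi).
Proof.
move=> [dphi _ _]; split=> x; apply/differentiable_continuous/derivable1_diffP.
  exact: (dphi 0%N).
exact: (dphi 1%N).
Qed.

(** Dominated convergence extends the defining identity to bounded limits of test functions. Almost
    everywhere convergence suffices for the derivatives, but [phi_] must converge at every point of
    [Omega] because [nu] may have atoms. *)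
Lemma distributional_derivative_lim (L M N : R) (w h V : R -> R) phi_ nu :
  let Omega : set R := `]- L, L[%classic in
  leb.-integrable Omega (EFin \o w) -> is_distributional_derivative Omega w nu ->
  (forall n, test_function Omega (phi_ n)) ->
  (forall n x, Omega x -> `|derive1 (phi_ n) x| <= M) ->
  (forall n x, Omega x -> `|phi_ n x| <= N) ->
  measurable_fun Omega h ->
  {ae leb, forall x, Omega x -> derive1 (phi_ n) x @[n --> \oo] --> h x} ->
  (forall x, Omega x -> phi_ n x @[n --> \oo] --> V x) ->
  Rintegral leb Omega (fun x => w x * h x) = - charge_integral nu Omega V.
Proof.
move=> Omega iw [_ dw] tphi dphiM phiN mh dphih phiV.
have mO : measurable (Omega : set mR) by exact: measurable_itv.
have mw : measurable_fun Omega w.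
  by apply/measurable_EFinP; exact: measurable_int iw.
have mphi n : measurable_fun Omega (phi_ n).
  apply: measurable_funTS; apply: continuous_measurable_fun.
  by case: (test_function_continuous (tphi n)).
have mdphi n : measurable_fun Omega (derive1 (phi_ n)).
  apply: measurable_funTS; apply: continuous_measurable_fun.
  by case: (test_function_continuous (tphi n)).
have lhs : Rintegral leb Omega (fun x => w x * derive1 (phi_ n) x) @[n --> \oo]
    --> Rintegral leb Omega (fun x => w x * h x).
  have := @cvg_Rintegral _ mR R leb Omega
    (fun n x => w x * derive1 (phi_ n) x) (fun x => w x * h x)
    (fun x => M * `|w x|); apply => //.
  - by move=> n; exact: measurable_funM mw (mdphi n).
  - exact: measurable_funM mw mh.
  - apply: filterS dphih; first exact: (ae_filter_ringOfSetsType leb).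
    by move=> x /[apply] hx; apply: cvgM => //; exact: cvg_cst.
  - exact: (integrableZl mO M (integrable_norm iw)).
  - by move=> n x Ox; rewrite normrM mulrC ler_wpM2r// dphiM.
have rhs := cvgN (cvg_charge_integral (nu := nu) mO mphi phiN phiV).
rewrite -(cvg_lim (@Rhausdorff R) lhs); apply/cvg_lim => //.
rewrite [X in X @ _ --> _](_ : _ = -%R \o (fun n => charge_integral nu Omega (phi_ n))).
  exact: rhs.
by apply/funext => n; rewrite dw.
Qed.

End charge_integral_theory.

(** * Uniqueness of the distributional derivative *)

Section charge_uniqueness.
Context {R : realType}.
Local Notation mR := (measurableTypeR R).
Local Notation leb := (@lebesgue_measure R).
Implicit Types (nu : {charge set mR -> \bar R}) (A : set mR).

Lemma charge_jordanE nu A : measurable A ->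
  nu A = (jordan_pos (hahn nu) A - jordan_neg (hahn nu) A)%E.
Proof. by move=> mA; rewrite (jordan_decomp (hahn nu) mA) /cadd/= cscaleN1. Qed.

(** The negative part of [A] is minus the charge of [A] cut with a negative set, on which a
    nonnegative charge vanishes. *)
Lemma ge0_charge_jordan nu : (forall A, measurable A -> (0 <= nu A)%E) ->
  forall A, measurable A ->
    jordan_pos (hahn nu) A = nu A /\ jordan_neg (hahn nu) A = 0%E.
Proof.
move=> nu0 A mA.
have neg0 : jordan_neg (hahn nu) A = 0%E.
  have [_ [mN negN] _ _] := hahn nu.
  rewrite jordan_negE cjordan_negE /crestr0 mem_set// /crestr.
  apply/eqP; rewrite oppe_eq0 eq_le nu0 ?andbT; last exact: measurableI.
  by apply: negN => //; exact: measurableI.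
by split=> //; rewrite (charge_jordanE nu mA) neg0 sube0.
Qed.

Lemma charge_integral_indic nu (D A : set mR) : measurable D -> measurable A ->
  charge_integral nu D (\1_A) = fine (nu (A `&` D)).
Proof.
move=> mD mA; have mAD : measurable (A `&` D) by exact: measurableI.
rewrite /charge_integral /Rintegral !integral_indic//.
rewrite (charge_jordanE nu mAD) fineB//; exact: fin_num_measure.
Qed.

(** Uniqueness on a pi-system is available for measures, so the Jordan parts, all finite, are moved
    across the equation: [m1] and [m2] agree exactly where the charges do. *)
Lemma charge_eq nu1 nu2 :
  (forall b, nu1 `]-oo, b[%classic = nu2 `]-oo, b[%classic) ->
  forall A, measurable A -> nu1 A = nu2 A.
Proof.
move=> nu12 A mA.
pose m1 : {measure set mR -> \bar R} :=
   measure_add (jordan_pos (hahn nu1)) (jordan_neg (hahn nu2)).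
pose m2 : {measure set mR -> \bar R} :=
   measure_add (jordan_pos (hahn nu2)) (jordan_neg (hahn nu1)).
have fin_pos nu B : measurable B -> jordan_pos (hahn nu) B \is a fin_num.
  by move=> mB; exact: fin_num_measure.
have fin_neg nu B : measurable B -> jordan_neg (hahn nu) B \is a fin_num.
  by move=> mB; exact: fin_num_measure.
have m1E B : m1 B = (jordan_pos (hahn nu1) B + jordan_neg (hahn nu2) B)%E.
  exact: measure_addE.
have m2E B : m2 B = (jordan_pos (hahn nu2) B + jordan_neg (hahn nu1) B)%E.
  exact: measure_addE.
have m12 B : measurable B -> (m1 B == m2 B) = (nu1 B == nu2 B).
  move=> mB; rewrite (charge_jordanE nu1 mB) (charge_jordanE nu2 mB).
  rewrite m1E m2E.
  move: (fin_pos nu1 B mB) (fin_pos nu2 B mB) (fin_neg nu1 B mB) (fin_neg nu2 B mB).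
  move: (jordan_pos (hahn nu1) B) (jordan_pos (hahn nu2) B)
    (jordan_neg (hahn nu1) B) (jordan_neg (hahn nu2) B).
  move=> [p1||]// [p2||]// [n1||]// [n2||]// _ _ _ _.
  by rewrite -!EFinD !eqe; apply/eqP/eqP; lra.
apply/eqP; rewrite -m12//; apply/eqP.
have := @measure_unique _ R mR (@RGenInftyO.G R) (fun n => `]-oo, n%:R[%classic)
  _ _ _ _ m1 m2; apply => //.
- exact: RGenInftyO.measurableE.
- move=> _ _ [x ->] [y ->]; exists (Num.min x y).
  by apply/seteqP; split=> z /=; rewrite !in_itv/= lt_min => /andP.
- by move=> n; exists n%:R.
- apply/seteqP; split=> // x _; exists (Num.truncn `|x|).+1 => //=.
  rewrite in_itv/= (le_lt_trans (ler_norm _))//.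
  by rewrite truncnS_gt.
- by move=> _ [x ->]; apply/eqP; rewrite m12//; apply/eqP.
- by move=> n; rewrite m1E ltey_eq fin_numD fin_pos ?fin_neg.
Qed.

(** By [charge_eq] it is enough to treat rays. A ray counts only through its trace on [Omega], an
    interval whose indicator is the pointwise limit of cutoffs, and both charges agree on these test
    functions. *)
Lemma distributional_derivative_unique (L : R) (u : R -> R) nu1 nu2 :
  let Omega : set R := `]- L, L[%classic in
  is_distributional_derivative Omega u nu1 ->
  is_distributional_derivative Omega u nu2 ->
  forall A, measurable A -> nu1 A = nu2 A.
Proof.
move=> Omega dnu1 dnu2; apply: charge_eq => b.
have mO : measurable (Omega : set mR) by exact: measurable_itv.
have mb (c : R) : measurable (`]-oo, c[%classic : set mR) by exact: measurable_itv.
have restrE nu : is_distributional_derivative Omega u nu ->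
    nu `]-oo, b[%classic = nu (`]- L, Num.min b L[%classic `&` Omega).
  move=> [nuO _]; rewrite (chargeDI nu (mb b) mO) [X in (X + _)%E]nuO.
  2: exact: measurableD.
  2: by rewrite setDE -setIA setICl setI0.
  rewrite add0e; congr (nu _); apply/seteqP.
  split=> x; rewrite /Omega /= !in_itv/= lt_min => -[].
    by move=> -> /andP[-> ->].
  by move=> /and3P[-> -> ->].
rewrite (restrE _ dnu1) (restrE _ dnu2); set B := `]- L, _[%classic.
have mB : measurable (B : set mR) by exact: measurable_itv.
have tphi n : test_function Omega (cutoff (- L) (Num.min b L) n).
  apply: test_function_cutoff.
  by move=> x; rewrite /Omega /= !in_itv/= lt_min => /and3P[-> _ ->].
have limB nu := cvg_charge_integral (nu := nu) (M := 1) mO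
  (f_ := cutoff (- L) (Num.min b L)) (f := \1_B).
have {}limB nu : charge_integral nu Omega (cutoff (- L) (Num.min b L) n)
    @[n --> \oo] --> fine (nu (B `&` Omega)).
  rewrite -charge_integral_indic//; apply: limB.
  - move=> n; apply: measurable_funTS; apply: continuous_measurable_fun.
    by apply: smooth_continuous; exact: smooth_cutoff.
  - by move=> n x _; rewrite ger0_norm ?cutoff_ge0// cutoff_le1.
  - by move=> x _; exact: cvg_cutoff.
have eqlim : fine (nu1 (B `&` Omega)) = fine (nu2 (B `&` Omega)).
  rewrite -(cvg_lim (@Rhausdorff R) (limB nu1)) -(cvg_lim (@Rhausdorff R) (limB nu2)).
  suff -> : (fun n => charge_integral nu1 Omega (cutoff (- L) (Num.min b L) n)) =
      (fun n => charge_integral nu2 Omega (cutoff (- L) (Num.min b L) n)) by [].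
  apply/funext => n; apply: oppr_inj.
  by rewrite -(dnu1.2 _ (tphi n)) -(dnu2.2 _ (tphi n)).
have mBO : measurable (B `&` Omega : set mR) by exact: measurableI.
by rewrite -[LHS]fineK ?fin_num_measure// eqlim fineK// fin_num_measure.
Qed.

End charge_uniqueness.

(** * Integrals on intervals and against charges *)

Section integrals_on_intervals.
Context {R : realType}.
Local Notation leb := (@lebesgue_measure R).
Implicit Types (F f : R -> R) (a b c : R).

(** Weak inequalities let pieces collapse, as happens below when [X = 0]. *)
Lemma Rintegral_oo_split f a b c : a <= b -> b <= c ->
  leb.-integrable `]a, c[%classic (EFin \o f) ->
  Rintegral leb `]a, c[ f = Rintegral leb `]a, b[ f + Rintegral leb `]b, c[ f.
Proof.
rewrite le_eqVlt => /predU1P[<- _ _|ab].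
  by rewrite set_itvoo0 Rintegral_set0 add0r.
rewrite le_eqVlt => /predU1P[-> _|bc intf].
  by rewrite [`]c, c[%classic]set_itvoo0 Rintegral_set0 addr0.
have /= <- := @Rintegral_itvB _ f (BRight a) (BLeft c) b intf _ _.
- rewrite -Rintegral_itv_bndo_bndc; first by rewrite addrC subrK.
  by apply: integrableS intf => //; apply: subset_itvl; rewrite bnd_simp ltW.
- by rewrite bnd_simp ltW.
- by rewrite bnd_simp.
Qed.

Lemma Rintegral_oo_derive F f a b : a <= b ->
  (forall x, is_derive x (1 : R) F (f x)) -> continuous f ->
  Rintegral leb `]a, b[ f = F b - F a.
Proof.
rewrite le_eqVlt => /predU1P[<- _ _|ab dF cf].
  by rewrite set_itvoo0 Rintegral_set0 subrr.
have cF : continuous F.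
  by move=> x; apply/differentiable_continuous/derivable1_diffP; exact: ex_derive.
have iab : leb.-integrable `[a, b]%classic (EFin \o f).
  apply: continuous_compact_integrable; first exact: segment_compact.
  exact: continuous_subspaceT.
rewrite Rintegral_itv_bndo_bndc; last first.
  by apply: integrableS iab => //; exact: subset_itv_oo_cc.
rewrite Rintegral_itv_obnd_cbnd; last first.
  by apply: integrableS iab => //; exact: subset_itv_oc_cc.
rewrite /Rintegral (@continuous_FTC2 _ f F a b)//.
- exact: continuous_subspaceT.
- split; first by move=> x _; exact: ex_derive.
    by apply: cvg_at_right_filter; exact: cF.
  by apply: cvg_at_left_filter; exact: cF.
- by move=> x _; rewrite derive1E derive_val.
Qed.

(** The fundamental theorem for the product [(p * x + q) * F x], to be used on each affine piece of
    the candidate. *)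
Lemma Rintegral_oo_affine_by_parts F f (p q a b : R) : a <= b ->
  (forall x, is_derive x (1 : R) F (f x)) -> continuous f ->
  Rintegral leb `]a, b[ (fun x => (p * x + q) * f x) =
  (p * b + q) * F b - (p * a + q) * F a - p * Rintegral leb `]a, b[ F.
Proof.
move=> ab dF cf.
have cF : continuous F.
  by move=> x; apply/differentiable_continuous/derivable1_diffP; exact: ex_derive.
have caff : continuous (fun x : R => p * x + q).
  by apply: smooth_continuous; exact: smooth_affine.
have ioo g : continuous g -> leb.-integrable `]a, b[%classic (EFin \o g).
  move=> cg; have icc : leb.-integrable `[a, b]%classic (EFin \o g).
    apply: continuous_compact_integrable; first exact: segment_compact.
    exact: continuous_subspaceT.
  by apply: integrableS icc => //; exact: subset_itv_oo_cc.
have dG x : is_derive x (1 : R) (fun x => (p * x + q) * F x)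
    ((p * x + q) * f x + p * F x).
  have -> : (fun x => (p * x + q) * F x) = (fun x => p * x + q) * F by [].
  have da := is_derive_affine p q x.
  by apply: is_derive_eq; rewrite /GRing.scale/= [F x * p]mulrC.
have caf : continuous (fun x => (p * x + q) * f x).
  by move=> x; apply: cvgM; [exact: caff|exact: cf].
have cpF : continuous (fun x => p * F x) by move=> x; apply: cvgM; [exact: cvg_cst|exact: cF].
have /(_ _)/esym := Rintegral_oo_derive ab dG; rewrite RintegralD//; last 2 first.
- exact: ioo.
- exact: ioo.
rewrite RintegralZl//; last exact: ioo.
by move=> ->; [rewrite addrK|move=> x; apply: cvgD; [exact: caf|exact: cpF]].
Qed.

End integrals_on_intervals.

(** * Integrals against the variation of a charge *)

Section variation.
Context {R : realType}.
Local Notation mR := (measurableTypeR R).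
Implicit Types (nu : {charge set mR -> \bar R}) (D : set mR) (f g : R -> R).

Lemma bounded_jordan_integrable nu D f (M : R) : measurable D ->
  measurable_fun D f -> (forall x, D x -> `|f x| <= M) ->
  (jordan_pos (hahn nu)).-integrable D (EFin \o f) /\
  (jordan_neg (hahn nu)).-integrable D (EFin \o f).
Proof.
move=> mD mf fM; split; apply: (finite_bounded_integrable mD _ mf fM);
  by rewrite ltey_eq fin_num_measure.
Qed.

(** The variation is the sum of the Jordan parts; boundedness of [f] keeps both integrals finite. *)
Lemma integral_variation nu D f (M : R) : measurable D ->
  measurable_fun D f -> (forall x, D x -> 0 <= f x <= M) ->
  (\int[variation_measure nu]_(x in D) (f x)%:E =
   (Rintegral (jordan_pos (hahn nu)) D f +
    Rintegral (jordan_neg (hahn nu)) D f)%:E)%E.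
Proof.
move=> mD mf fM.
have fM' x : D x -> `|f x| <= M by move=> /fM /andP[f0 ?]; rewrite ger0_norm.
have [ip ineg] := bounded_jordan_integrable nu mD mf fM'.
rewrite EFinD /Rintegral !fineK//; try exact: integrable_fin_num.
rewrite -ge0_integral_measure_add//.
- by apply: eq_measure_integral => A mA _; exact/esym/measure_addE.
- by move=> x /fM /andP[f0 _]; rewrite lee_fin.
- exact/measurable_EFinP.
Qed.

(** The inequality behind the calibration, with [f] the potential and [g] the weight: [f <= g] is
    integrated against the positive part and [- f <= g] against the negative part. *)
Lemma charge_integral_le_variation nu D f g (M : R) : measurable D ->
  measurable_fun D f -> measurable_fun D g ->
  (forall x, D x -> `|f x| <= g x <= M) ->
  ((charge_integral nu D f)%:E <= \int[variation_measure nu]_(x in D) (g x)%:E)%E.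
Proof.
move=> mD mf mg fgM.
have fM x : D x -> `|f x| <= M by move=> /fgM /andP[]; exact: le_trans.
have g0 x : D x -> 0 <= g x by move=> /fgM /andP[+ _]; exact: le_trans.
have gM x : D x -> 0 <= g x <= M by move=> Dx; rewrite g0//; case/andP: (fgM x Dx).
have gM' x : D x -> `|g x| <= M by move=> /gM /andP[? ?]; rewrite ger0_norm.
rewrite (integral_variation nu mD mg gM) lee_fin /charge_integral.
have [ifp ifn] := bounded_jordan_integrable nu mD mf fM.
have [igp ign] := bounded_jordan_integrable nu mD mg gM'.
apply: lerD.
  apply: le_Rintegral => // x /fgM /andP[+ _]; apply: le_trans; exact: ler_norm.
rewrite -[leLHS]mulN1r -RintegralZl//; apply: le_Rintegral => //.
  exact: (integrableZl mD (-1) ifn).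
by move=> x /fgM /andP[+ _]; apply: le_trans; rewrite mulN1r -normrN ler_norm.
Qed.

Lemma ge0_charge_integral_variation nu D f (M : R) : measurable D ->
  measurable_fun D f -> (forall x, D x -> 0 <= f x <= M) ->
  (forall A, measurable A -> (0 <= nu A)%E) ->
  (\int[variation_measure nu]_(x in D) (f x)%:E = (charge_integral nu D f)%:E)%E.
Proof.
move=> mD mf fM nu0; rewrite (integral_variation nu mD mf fM) /charge_integral.
suff -> : Rintegral (jordan_neg (hahn nu)) D f = 0 by rewrite addr0 subr0.
rewrite /Rintegral (@eq_measure_integral _ _ _ _ mzero).
  by rewrite integral_measure_zero.
by move=> A mA _; exact: (ge0_charge_jordan nu0 mA).2.
Qed.

End variation.

(** * Scaled and restricted measures *)

Section scaled_and_restricted_measures.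
Context d (T : measurableType d) (R : realType).
Variables (mu : {measure set T -> \bar R}).
Implicit Types (D A : set T) (f : T -> \bar R).

Lemma integral_mscale D (k : {nonneg R}) f : measurable D ->
  mu.-integrable D f ->
  (\int[mscale k mu]_(x in D) f x = k%:num%:E * \int[mu]_(x in D) f x)%E.
Proof.
move=> mD intf; have mf := measurable_int mu intf.
rewrite [LHS]integralE [X in (_ * X)%E]integralE muleBr//; last first.
  by rewrite fin_num_adde_defl// fin_numN integrable_neg_fin_num.
congr (_ - _)%E; rewrite ge0_integral_mscale//.
- exact: measurable_funepos.
- exact: measurable_funeneg.
Qed.

(** The complement of [A] is null for the restriction, and the two measures agree on subsets of
    [A]. *)
Lemma integral_mrestr D A (mA : measurable A) f : measurable D ->
  A `<=` D -> (mrestr mu mA).-integrable D f ->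
  (\int[mrestr mu mA]_(x in D) f x = \int[mu]_(x in A) f x)%E.
Proof.
move=> mD AD intf.
rewrite (@negligible_integral _ _ _ _ D (~` A))//.
- rewrite setDE setCK (setIidr AD).
  apply: eq_measure_integral => B mB BA.
  by transitivity (mu (B `&` A)); [|rewrite setIidl].
- exact: measurableC.
- by transitivity (mu (~` A `&` A)); [|rewrite setICl measure0].
Qed.

End scaled_and_restricted_measures.

(** * The derivative measure of the candidate *)

Section candidate_derivative.
Context {R : realType}.
Local Notation mR := (measurableTypeR R).
Local Notation leb := (@lebesgue_measure R).
Variables (lambda K X : R).

Let mI : measurable (`]- X, X[%classic : set mR).
Proof. exact: measurable_itv. Qed.

Let Ifin : (leb `](- X)%R, X[%classic < +oo)%E.
Proof. by rewrite lebesgue_measure_itv; case: ifPn => // _; rewrite -EFinB ltry. Qed.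

(* The derivative of [candidate] below, which has slope [lambda] on [(-X, X)], a
   jump of height [2K] at [0], and is constant elsewhere. *)
Definition jump_slope_charge : {charge set mR -> \bar R} :=
  cadd (cscale (2 * K) (charge_of_finite_measure (\d_(0%R : mR))))
       (cscale lambda (charge_of_finite_measure (mfrestr mI Ifin))).

Lemma jump_slope_chargeE (A : set mR) : jump_slope_charge A =
  ((2 * K)%R%:E * \d_(0%R : mR) A + lambda%:E * leb (A `&` `](- X)%R, X[%classic))%E.
Proof. by []. Qed.

Hypotheses (lambda_ge0 : 0 <= lambda) (K_ge0 : 0 <= K).

Lemma jump_slope_charge_ge0 (A : set mR) : measurable A ->
  (0 <= jump_slope_charge A)%E.
Proof.
move=> mA; rewrite jump_slope_chargeE adde_ge0// mule_ge0// lee_fin//.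
by rewrite mulr_ge0.
Qed.

(** Stated for any charge equal to [jump_slope_charge] on measurable sets, so as to apply also to
    the derivative selected by [Du]. *)
Lemma charge_integral_jump_slope (nu : {charge set mR -> \bar R}) (D : set mR)
    (f : R -> R) (M : R) :
  (forall A, measurable A -> nu A = jump_slope_charge A) ->
  measurable D -> D 0 -> `]- X, X[%classic `<=` D ->
  measurable_fun D f -> (forall x, D x -> `|f x| <= M) ->
  charge_integral nu D f = 2 * K * f 0 + lambda * Rintegral leb `]- X, X[ f.
Proof.
move=> nuE mD D0 XD mf fM.
have nu0 A : measurable A -> (0 <= nu A)%E.
  by move=> mA; rewrite nuE//; exact: jump_slope_charge_ge0.
have K2 : 0 <= 2 * K by rewrite mulr_ge0.
pose m1 := mscale (NngNum K2) (\d_(0%R : mR)).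
pose m2 := mscale (NngNum lambda_ge0) (mrestr leb mI).
have mEf : measurable_fun D (EFin \o f) by exact/measurable_EFinP.
have i0 : (\d_(0%R : mR)).-integrable D (EFin \o f).
  by apply: finite_bounded_integrable fM => //; rewrite ltey_eq fin_num_measure.
have Dfin : (mrestr leb mI D < +oo)%E.
  by move: Ifin; rewrite -{1}(setIidr XD).
have ir : (mrestr leb mI).-integrable D (EFin \o f).
  exact: finite_bounded_integrable fM.
have i1 : m1.-integrable D (EFin \o f).
  apply: finite_bounded_integrable fM => //.
  by apply: lte_mul_pinfty; rewrite // ltey_eq fin_num_measure.
have i2 : m2.-integrable D (EFin \o f).
  apply: finite_bounded_integrable fM => //.
  exact: lte_mul_pinfty.
have iX : leb.-integrable `]- X, X[%classic (EFin \o f).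
  apply: finite_bounded_integrable => //.
    by apply: measurable_funS mf.
  by move=> x /XD; exact: fM.
(* As [nu] is nonnegative, its negative part is zero and its positive part is the sum of the two
   measures. *)
have -> : charge_integral nu D f = Rintegral (measure_add m1 m2) D f.
  rewrite /charge_integral [X in _ - X](_ : _ = 0) ?subr0.
    congr fine; apply: eq_measure_integral => A mA _.
    transitivity (nu A); first exact: (ge0_charge_jordan nu0 mA).1.
    by rewrite nuE//; exact/esym/measure_addE.
  rewrite /Rintegral (@eq_measure_integral _ _ _ _ mzero).
    by rewrite integral_measure_zero.
  by move=> A mA _; exact: (ge0_charge_jordan nu0 mA).2.
rewrite /Rintegral integral_measure_add// integral_mscale// integral_mscale//.
rewrite integral_dirac// diracE mem_set// mul1e integral_mrestr//.
by rewrite fineD ?fineM// ?fin_numM// integrable_fin_num.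
Qed.

End candidate_derivative.

(** * The candidate minimizer *)

Section candidate.
Context {R : realType}.
Local Notation mR := (measurableTypeR R).
Local Notation leb := (@lebesgue_measure R).
Variables (L lambda K X : R).
Hypotheses (lambda_ge0 : 0 <= lambda) (K_ge0 : 0 <= K).
Hypotheses (X_ge0 : 0 <= X) (X_lt : X < L).
Let Omega : set R := `]- L, L[%classic.

(* The candidate minimizer minus the datum [fun x => lambda * x]. *)
Definition residual (x : R) : R :=
  if x < - X then - K - lambda * (x + X)
  else if x < 0 then - K
  else if x < X then K
  else K - lambda * (x - X).

Definition candidate x := lambda * x + residual x.

(* The primitive of [residual] vanishing at [- L], and also at [L]. *)
Definition potential (x : R) : R :=
  lambda * (L - X) ^+ 2 / 2 - K * (L - `|x|)
  - lambda * (Num.max 0 (`|x| - X)) ^+ 2 / 2.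

Lemma measurable_residual : measurable_fun setT residual.
Proof.
have maff (p q : R) : measurable_fun setT (fun x : R => p * x + q).
  by apply: continuous_measurable_fun; apply: smooth_continuous; exact: smooth_affine.
apply: measurable_fun_ifT; first exact: measurable_fun_ltr.
  rewrite (_ : (fun x => _) = (fun x => - lambda * x + (- K - lambda * X)))//.
  by apply/funext => x; ring.
apply: measurable_fun_ifT => //; first exact: measurable_fun_ltr.
apply: measurable_fun_ifT => //; first exact: measurable_fun_ltr.
rewrite (_ : (fun x => _) = (fun x => - lambda * x + (K + lambda * X)))//.
by apply/funext => x; ring.
Qed.

Lemma measurable_candidate : measurable_fun setT candidate.
Proof.
apply: measurable_funD; last exact: measurable_residual.
exact: measurable_funM.
Qed.

Lemma residual_bound x : Omega x -> `|residual x| <= K + lambda * L.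
Proof.
move: (lambda_ge0) (K_ge0) (X_ge0) (X_lt) => l0 K0 X0 XL.
rewrite /Omega/= in_itv/= => /andP[xL Lx].
have norm_le (a b : R) : - b <= a -> a <= b -> `|a| <= b.
  by move=> ba ab; rewrite ler_norml ba.
have L0 : 0 <= L by lra.
(* Supplying the signs of the products with [lambda] leaves linear goals for [lra]. *)
have lL : 0 <= lambda * L by rewrite mulr_ge0.
have lX : 0 <= lambda * X by rewrite mulr_ge0.
have lxL : 0 <= lambda * (x + L) by rewrite mulr_ge0//; lra.
have lLx : 0 <= lambda * (L - x) by rewrite mulr_ge0//; lra.
rewrite /residual; case: ifPn => [xX|_].
  have lxX : 0 <= lambda * (- x - X) by rewrite mulr_ge0//; lra.
  by apply: norm_le; lra.
case: ifPn => [x0|_]; first by apply: norm_le; lra.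
case: ifPn => [xX|]; first by apply: norm_le; lra.
rewrite -leNgt => xX.
have lxX : 0 <= lambda * (x - X) by rewrite mulr_ge0//; lra.
by apply: norm_le; lra.
Qed.

Lemma candidate_bound x : Omega x -> `|candidate x| <= K + 2 * lambda * L.
Proof.
move: (lambda_ge0) (K_ge0) (X_ge0) (X_lt) => l0 K0 X0 XL.
move=> Ox; rewrite (le_trans (ler_normD _ _))//.
have := residual_bound Ox; move: Ox; rewrite /Omega/= in_itv/= => /andP[xL Lx].
have : `|x| <= L by rewrite ler_norml !ltW.
by rewrite normrM (ger0_norm lambda_ge0); nra.
Qed.

Lemma integrable_Omega (f : R -> R) (M : R) : measurable_fun setT f ->
  (forall x, Omega x -> `|f x| <= M) -> leb.-integrable Omega (EFin \o f).
Proof.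
have Ofin : (leb `](- L)%R, L[%classic < +oo)%E.
  by rewrite lebesgue_measure_itv; case: ifPn => // _; rewrite -EFinB ltry.
move=> mf fM; apply: (@finite_bounded_integrable _ mR _ leb Omega f M) => //.
- exact: measurable_itv.
- exact: measurable_funTS.
Qed.

Lemma integrable_residual a b : - L <= a -> b <= L ->
  leb.-integrable `]a, b[%classic (EFin \o residual).
Proof.
move=> La bL.
apply: (integrableS _ _ _ (integrable_Omega measurable_residual residual_bound)).
- exact: measurable_itv.
- exact: measurable_itv.
move=> x; rewrite /Omega/= !in_itv/= => /andP[ax xb].
by rewrite (le_lt_trans La ax) (lt_le_trans xb bL).
Qed.

Lemma Rintegral_oo_affine (p q a b : R) : a <= b ->
  Rintegral leb `]a, b[ (fun x => p * x + q) =
  p * (b ^+ 2 - a ^+ 2) / 2 + q * (b - a).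
Proof.
move=> ab; have dF x : is_derive x (1 : R) (fun x => (p / 2 * x + q) * x) (p * x + q).
  have -> : (fun x => (p / 2 * x + q) * x) = (fun x => p / 2 * x + q) * id by [].
  have da := is_derive_affine (p / 2) q x.
  by apply: is_derive_eq; rewrite /GRing.scale/=; field.
rewrite (Rintegral_oo_derive ab dF).
  by field.
by apply: smooth_continuous; exact: smooth_affine.
Qed.

Lemma Rintegral_residual_piece (p q a b : R) : a <= b ->
  (forall x, a < x < b -> residual x = p * x + q) ->
  Rintegral leb `]a, b[ residual = p * (b ^+ 2 - a ^+ 2) / 2 + q * (b - a).
Proof.
move=> ab pq; rewrite -Rintegral_oo_affine//; apply: eq_Rintegral => x.
by rewrite inE/= in_itv; exact: pq.
Qed.

(** The residual is affine on four intervals. The integral is built from left to right, each piece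
    starting from the value of the potential at the previous breakpoint. *)
Lemma Rintegral_residual x : - L <= x -> x <= L ->
  Rintegral leb `]- L, x[ residual = potential x.
Proof.
move: (lambda_ge0) (K_ge0) (X_ge0) (X_lt) => l0 K0 X0 XL.
have split a b : - L <= a -> a <= b -> b <= L ->
    Rintegral leb `]- L, b[ residual =
    Rintegral leb `]- L, a[ residual + Rintegral leb `]a, b[ residual.
  by move=> La ab bL; apply: Rintegral_oo_split => //; exact: integrable_residual.
have left y : - L <= y -> y <= - X ->
    Rintegral leb `]- L, y[ residual = potential y.
  move=> Ly yX; rewrite (@Rintegral_residual_piece (- lambda) (- K - lambda * X))//.
    rewrite /potential ler0_norm ?(le_trans yX) ?oppr_le0// (elimT max_idPr); last lra.
    by field.
  by move=> z /andP[_ zy]; rewrite /residual ifT; [ring|lra].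
have midleft y : - X <= y -> y <= 0 ->
    Rintegral leb `]- L, y[ residual = potential y.
  have LX : - L <= - X by lra.
  move=> Xy y0; have yL : y <= L by lra.
  rewrite (split (- X) y LX Xy yL) (left _ LX (lexx _)).
  rewrite (@Rintegral_residual_piece 0 (- K))//.
    rewrite /potential !ler0_norm ?oppr_le0// (elimT max_idPl); last lra.
    by rewrite (elimT max_idPl); [field|lra].
  move=> z /andP[Xz zy]; rewrite /residual ifF; last by apply/negbTE; lra.
  by rewrite ifT; [ring|lra].
have midright y : 0 <= y -> y <= X ->
    Rintegral leb `]- L, y[ residual = potential y.
  move=> y0 yX; have yL : y <= L by lra.
  have L0 : - L <= 0 by lra.
  have X0' : - X <= 0 by lra.
  rewrite (split 0 y L0 y0 yL) (midleft _ X0' (lexx _)) (@Rintegral_residual_piece 0 K)//.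
    rewrite /potential !ger0_norm// (elimT max_idPl); last lra.
    by rewrite (elimT max_idPl); [field|lra].
  move=> z /andP[z0 zy]; rewrite /residual ifF; last by apply/negbTE; lra.
  rewrite ifF; last by apply/negbTE; lra.
  by rewrite ifT; [ring|lra].
have right y : X <= y -> y <= L ->
    Rintegral leb `]- L, y[ residual = potential y.
  move=> Xy yL; have LX : - L <= X by lra.
  rewrite (split X y LX Xy yL) (midright _ X0 (lexx _)).
  rewrite (@Rintegral_residual_piece (- lambda) (K + lambda * X))//.
    rewrite /potential !ger0_norm ?(le_trans X_ge0)// (elimT max_idPl); last lra.
    by rewrite (elimT max_idPr); [field|lra].
  move=> z /andP[z0 zy]; rewrite /residual ifF; last by apply/negbTE; lra.
  rewrite ifF; last by apply/negbTE; lra.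
  by rewrite ifF; [ring|apply/negbTE; lra].
move=> Lx xL; have [xX|/ltW Xx] := leP x (- X); first exact: left.
have [x0|/ltW x0] := leP x 0; first exact: midleft.
by have [xX|/ltW xX] := leP x X; [exact: midright|exact: right].
Qed.

Lemma continuous_bounded (f : R -> R) : continuous f ->
  exists M, forall x, Omega x -> `|f x| <= M.
Proof.
move=> cf; have /compact_bounded[M [_ HM]] : compact (f @` `[- L, L]%classic).
  apply: continuous_compact; last exact: segment_compact.
  exact: continuous_subspaceT.
(* [HM] provides only the bounds strictly above [M]. *)
exists (M + 1) => x; rewrite /Omega/= in_itv/= => /andP[Lx xL].
apply: HM; first by rewrite ltrDl.
by exists x => //=; rewrite in_itv/= !ltW.
Qed.

(** Integration by parts on the four affine pieces. The endpoint terms vanish at [- L] and [L],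
    cancel between adjacent pieces at [- X] and [X], and leave [- 2 * K * phi 0] at the jump. *)
Lemma candidate_distributional_derivative :
  is_distributional_derivative Omega candidate (jump_slope_charge lambda K X).
Proof.
move: (lambda_ge0) (K_ge0) (X_ge0) (X_lt) => l0 K0 X0 XL.
have O0 : Omega 0 by rewrite /Omega/= in_itv/=; apply/andP; split; lra.
have XO : `]- X, X[%classic `<=` Omega.
  by move=> x; rewrite /Omega/= !in_itv/= => /andP[? ?]; apply/andP; split; lra.
split=> [A mA AO|phi tphi].
  rewrite jump_slope_chargeE diracE memNset/=; last first.
    by move=> A0; have : set0 (0 : R) by rewrite -AO.
  rewrite mule0 add0e (_ : A `&` _ = set0) ?measure0 ?mule0//.
  by apply/seteqP; split=> // x [Ax /XO Ox]; rewrite -AO.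
have [cphi cdphi] := test_function_continuous tphi.
have dphi x : is_derive x (1 : R) phi (derive1 phi x).
  have [/(_ 0%N) d _ _] := tphi.
  by apply: DeriveDef; [exact: d|rewrite derive1E].
have phi_out x : ~ Omega x -> phi x = 0.
  have [_ _ supp] := tphi.
  move=> Ox; apply/eqP/negPn/negP => phix; apply: Ox; apply: supp.
  exact: subset_closure.
have phiL : phi L = 0 by apply: phi_out; rewrite /Omega/= in_itv/= ltxx andbF.
have phiNL : phi (- L) = 0 by apply: phi_out; rewrite /Omega/= in_itv/= ltxx.
have [M phiM] := continuous_bounded cphi.
have mphi : measurable_fun setT phi by exact: continuous_measurable_fun.
rewrite (charge_integral_jump_slope (X := X) l0 K0 (M := M))//; last 2 first.
- exact: measurable_itv.
- exact: measurable_funTS.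
have icc a b g : continuous g -> leb.-integrable `]a, b[%classic (EFin \o g).
  move=> cg; have : leb.-integrable `[a, b]%classic (EFin \o g).
    apply: continuous_compact_integrable; first exact: segment_compact.
    exact: continuous_subspaceT.
  by apply: integrableS => //; exact: subset_itv_oo_cc.
have [N uphiN] : exists N, forall x, Omega x -> `|candidate x * derive1 phi x| <= N.
  have [N dphiN] := continuous_bounded cdphi.
  exists ((K + 2 * lambda * L) * N) => x Ox.
  by rewrite normrM ler_pM// ?candidate_bound// dphiN.
have iuphi a b : - L <= a -> b <= L ->
    leb.-integrable `]a, b[%classic (EFin \o (fun x => candidate x * derive1 phi x)).
  move=> La bL.
  apply: (integrableS _ _ _ (integrable_Omega _ uphiN)).
  - exact: measurable_itv.
  - exact: measurable_itv.
  - move=> x; rewrite /Omega/= !in_itv/= => /andP[ax xb].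
    by rewrite (le_lt_trans La ax) (lt_le_trans xb bL).
  - apply: measurable_funM; first exact: measurable_candidate.
    exact: continuous_measurable_fun.
have split a b c : - L <= a -> a <= b -> b <= c -> c <= L ->
    Rintegral leb `]a, c[ (fun x => candidate x * derive1 phi x) =
    Rintegral leb `]a, b[ (fun x => candidate x * derive1 phi x) +
    Rintegral leb `]b, c[ (fun x => candidate x * derive1 phi x).
  by move=> La ab bc cL; apply: Rintegral_oo_split => //; exact: iuphi.
have piece p q a b : a <= b ->
    (forall x, a < x < b -> candidate x = p * x + q) ->
    Rintegral leb `]a, b[ (fun x => candidate x * derive1 phi x) =
    (p * b + q) * phi b - (p * a + q) * phi a - p * Rintegral leb `]a, b[ phi.
  move=> ab upq; rewrite -Rintegral_oo_affine_by_parts//.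
  by apply: eq_Rintegral => x; rewrite inE/= in_itv/= => /upq ->.
have XN0 : - X <= 0 by lra.
rewrite /Omega (split _ (- X))//; [|lra..].
rewrite (split (- X) 0)//; [|lra..].
rewrite (split 0 X)//; [|lra..].
rewrite (piece 0 (- K - lambda * X) (- L)); [|lra|]; last first.
  by move=> x /andP[Lx xX]; rewrite /candidate /residual ifT; [ring|lra].
rewrite (piece lambda (- K) (- X))//; last first.
  move=> x /andP[Xx x0]; rewrite /candidate /residual ifF; last by apply/negbTE; lra.
  by rewrite ifT//; ring.
rewrite (piece lambda K 0)//; last first.
  move=> x /andP[x0 xX]; rewrite /candidate /residual ifF; last by apply/negbTE; lra.
  by rewrite ifF ?xX; [ring|apply/negbTE; lra].
rewrite (piece 0 (K + lambda * X) X); [|lra|]; last first.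
  move=> x /andP[xX x0]; rewrite /candidate /residual ifF; last by apply/negbTE; lra.
  rewrite ifF; last by apply/negbTE; lra.
  by rewrite ifF; [ring|apply/negbTE; lra].
rewrite (@Rintegral_oo_split _ phi (- X) 0 X)//; last exact: icc.
by rewrite phiL phiNL; ring.
Qed.

End candidate.

(** * Integration by parts against the potential *)

Section calibration.
Context {R : realType}.
Local Notation mR := (measurableTypeR R).
Local Notation leb := (@lebesgue_measure R).
Variables (L lambda K X : R).
Hypotheses (lambda_ge0 : 0 <= lambda) (K_ge0 : 0 <= K).
Hypotheses (X_ge0 : 0 <= X) (X_lt : X < L).
Let Omega : set R := `]- L, L[%classic.

(* As [n] grows, [flat_at n s y] tends to the indicator of [s * (x - y) > 0], so
   that [smooth_residual n] below is an odd, compactly supported smooth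
   approximation of [residual]; being odd, it has a primitive that is again
   compactly supported. *)
Let flat_at n (s y x : R) := flat 0 (n.+1%:R * s * x + (- n.+1%:R * s * y)).

(** With indicators in place of [flat_at], this is [residual] away from 0 in a single formula: [K]
    times the sign of [x], minus [lambda] times the signed excess of [x] beyond [[- X, X]]. *)
Let smooth_residual_core n (x : R) : R :=
  K * (flat_at n 1 0 x - flat_at n (-1) 0 x)
  - lambda * ((x - X) * flat_at n 1 X x + (x + X) * flat_at n (-1) (- X) x).

Let smooth_residual n (x : R) : R :=
  smooth_residual_core n x * cutoff (- L) L n x.

Let flat_atE n s y x : flat_at n s y x = flat 0 (n.+1%:R * (s * (x - y)) + 0).
Proof. by rewrite /flat_at; congr (flat 0 _); ring. Qed.

Let flat_atN n s y x : flat_at n s y (- x) = flat_at n (- s) (- y) x.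
Proof. by rewrite !flat_atE; congr (flat 0 _); ring. Qed.

Let flat_at_le1 n s y x : `|flat_at n s y x| <= 1.
Proof. by rewrite ger0_norm ?flat_ge0 ?flat0_le1. Qed.

Let cvg_flat_at s y x :
  flat_at n s y x @[n --> \oo] --> (if 0 < s * (x - y) then 1 else 0 : R).
Proof.
rewrite (_ : (fun n => _) = fun n => flat 0 (n.+1%:R * (s * (x - y)) + 0)); last first.
  by apply/funext => n; rewrite flat_atE.
case: ifPn => [sxy|]; first exact: cvg_flat0_scaled.
rewrite -leNgt => sxy.
rewrite (_ : (fun n => _) = cst 0); first exact: cvg_cst.
by apply/funext => n; rewrite flat_le0// addr0 mulr_ge0_le0.
Qed.

Let smooth_smooth_residual n : smooth (smooth_residual n).
Proof.
have sfl s y : smooth (flat_at n s y).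
  by apply: smooth_comp_affine; exact: smooth_flat.
have -> : smooth_residual n =
    (((fun=> K) \* (flat_at n 1 0 \+ ((fun=> -1) \* flat_at n (-1) 0))) \+
     ((fun=> - lambda) \*
       (((fun x => 1 * x + (- X)) \* flat_at n 1 X) \+
        ((fun x => 1 * x + X) \* flat_at n (-1) (- X))))) \* cutoff (- L) L n.
  by apply/funext => x /=; rewrite /smooth_residual /smooth_residual_core; ring.
apply: smoothM; last exact: smooth_cutoff.
apply: smoothD; apply: smoothM; try exact: smooth_cst.
  apply: smoothD => //; apply: smoothM => //; exact: smooth_cst.
by apply: smoothD; apply: smoothM => //; exact: smooth_affine.
Qed.

Let smooth_residual_odd n x : smooth_residual n (- x) = - smooth_residual n x.
Proof.
rewrite /smooth_residual /smooth_residual_core.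
have -> : cutoff (- L) L n (- x) = cutoff (- L) L n x.
  by rewrite /cutoff mulrC; congr (flat 0 _ * flat 0 _); ring.
by rewrite !flat_atN !opprK !oppr0; ring.
Qed.

Let smooth_residual_support n x : smooth_residual n x != 0 ->
  - (L - n.+1%:R^-1) <= x <= L - n.+1%:R^-1.
Proof.
by rewrite mulf_eq0 negb_or => /andP[_ /cutoff_support]; rewrite opprB addrC.
Qed.

(** All [flat_at] and cutoff factors are at most 1, and [x - X] and [x + X] are at most [2 * L] in
    absolute value. *)
Let smooth_residual_bound n x : Omega x ->
  `|smooth_residual n x| <= 2 * K + 4 * lambda * L.
Proof.
move: (lambda_ge0) (K_ge0) (X_ge0) (X_lt) => l0 K0 X0 XL.
rewrite /Omega/= in_itv/= => /andP[Lx xL].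
rewrite normrM -[leRHS]mulr1 ler_pM//; last first.
  by rewrite ger0_norm ?cutoff_ge0// cutoff_le1.
rewrite (le_trans (ler_normB _ _))// lerD//.
  rewrite normrM ger0_norm// mulrC ler_wpM2r//.
  by rewrite (le_trans (ler_normB _ _))// -[leRHS]/(1 + 1) lerD.
rewrite normrM ger0_norm// -mulrA mulrCA ler_wpM2l//.
have xX : `|x - X| <= 2 * L by rewrite ler_norml; apply/andP; split; lra.
have xX' : `|x + X| <= 2 * L by rewrite ler_norml; apply/andP; split; lra.
rewrite (le_trans (ler_normD _ _))// (_ : 4 * L = 2 * L * 1 + 2 * L * 1); last by ring.
by rewrite !normrM lerD// ler_pM.
Qed.

(** At 0 the approximations vanish, being odd, while [residual] takes the value [K]. *)
Let cvg_smooth_residual x : Omega x -> x != 0 ->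
  smooth_residual n x @[n --> \oo] --> residual lambda K X x.
Proof.
move: (lambda_ge0) (K_ge0) (X_ge0) (X_lt) => l0 K0 X0 XL.
move=> Ox x0.
have ccut : cutoff (- L) L n x @[n --> \oo] --> (1 : R).
  have := @cvg_cutoff _ (- L) L x; rewrite indicE mem_set//.
rewrite -[residual _ _ _ _]mulr1; apply: cvgM => //.
pose i (b : bool) : R := if b then 1 else 0.
have -> : residual lambda K X x = K * (i (0 < 1 * (x - 0)) - i (0 < -1 * (x - 0)))
    - lambda * ((x - X) * i (0 < 1 * (x - X)) + (x + X) * i (0 < -1 * (x - (- X)))).
  have -> : (0 < 1 * (x - 0)) = (0 < x) by apply/idP/idP => ?; lra.
  have -> : (0 < -1 * (x - 0)) = (x < 0) by apply/idP/idP => ?; lra.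
  have -> : (0 < 1 * (x - X)) = (X < x) by apply/idP/idP => ?; lra.
  have -> : (0 < -1 * (x - - X)) = (x < - X) by apply/idP/idP => ?; lra.
  rewrite /residual /i; case: (ltgtP x 0) x0 => // x0 _.
    have -> : (X < x) = false by apply/negbTE; lra.
    by case: (ltgtP x (- X)) => xX; rewrite ?xX; ring.
  have -> : (x < - X) = false by apply/negbTE; lra.
  by case: (ltgtP x X) => xX; rewrite ?xX; ring.
apply: cvgB; apply: cvgM; try exact: cvg_cst.
  by apply: cvgB; exact: cvg_flat_at.
by apply: cvgD; apply: cvgM; try exact: cvg_cst; exact: cvg_flat_at.
Qed.

(** The potential is not a test function, but the primitives [phi_] of the smooth residuals are.
    They converge to it with uniform bounds, and [distributional_derivative_lim] applies. *)
Lemma calibration_identity (w : R -> R) (nu : {charge set mR -> \bar R}) :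
  leb.-integrable Omega (EFin \o w) -> is_distributional_derivative Omega w nu ->
  Rintegral leb Omega (fun x => w x * residual lambda K X x) =
  - charge_integral nu Omega (potential L lambda K X).
Proof.
move: (lambda_ge0) (K_ge0) (X_ge0) (X_lt) => l0 K0 X0 XL iw dw.
have L0 : 0 < L by lra.
pose phi_ n x := Rintegral leb `]-oo, x] (smooth_residual n).
have phiP n : test_function Omega (phi_ n) /\
    forall x, derive1 (phi_ n) x = smooth_residual n x.
  (* The maximum with [L / 2] keeps [a] positive, since [L - n.+1%:R^-1] may not be. *)
  have [a [a0 aL La]] : exists a, [/\ 0 < a, a < L & L - n.+1%:R^-1 <= a].
    exists (Num.max (L / 2) (L - n.+1%:R^-1)); split.
    - by rewrite lt_max divr_gt0.
    - rewrite gt_max ltr_pdivrMr// ltr_pMr// ltr1n/= ltrBlDr ltrDl.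
      by rewrite invr_gt0.
    - by rewrite le_max lexx orbT.
  apply: (@odd_test_function_antiderivative _ L a) => //.
  move=> x /smooth_residual_support /andP[ax xa].
  by rewrite (le_trans _ ax) ?lerN2// (le_trans xa).
(* The smooth residual vanishes to the left of [- L], so its primitive may as well start there. *)
have phiE n x : Omega x -> phi_ n x = Rintegral leb `]- L, x[ (smooth_residual n).
  rewrite /Omega/= in_itv/= => /andP[Lx xL].
  rewrite Rintegral_itv_bndo_bndc; last first.
    have cs : continuous (smooth_residual n) by exact: smooth_continuous.
    have : leb.-integrable `[- L, x]%classic (EFin \o smooth_residual n).
      apply: continuous_compact_integrable; first exact: segment_compact.
      exact: continuous_subspaceT.
    by apply: integrableS => //; exact: subset_itv_oo_cc.
  rewrite /phi_ Rintegral_mkcond [RHS]Rintegral_mkcond.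
  congr Rintegral; apply/funext => y; rewrite !patchE.
  have [yx|yx] := boolP (y \in `]-oo, x]%classic); last first.
    rewrite ifF//; apply: contraNF yx; rewrite !inE/= !in_itv/=.
    by move=> /andP[].
  case: ifPn => // yLx; apply/eqP; apply: contraNT yLx => /smooth_residual_support.
  move=> /andP[Ly _]; move: yx; rewrite !inE/= !in_itv/= => ->; rewrite andbT.
  by rewrite (lt_le_trans _ Ly)// ltrN2 gtrBl invr_gt0.
have subO x : Omega x -> `]- L, x[%classic `<=` Omega.
  rewrite /Omega/= in_itv/= => /andP[_ xL] y /=; rewrite !in_itv/=.
  by move=> /andP[-> /lt_trans]; exact.
have mitv x : measurable (`]- L, x[%classic : set mR) by exact: measurable_itv.
have fin_itv x : (leb `](- L)%R, x[%classic < +oo)%E.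
  by rewrite lebesgue_measure_itv; case: ifPn => // _; rewrite -EFinB ltry.
have msr n : measurable_fun setT (smooth_residual n).
  by apply: continuous_measurable_fun; exact: smooth_continuous.
have icst x (M : R) : leb.-integrable `]- L, x[%classic (EFin \o cst M).
  by apply: (finite_bounded_integrable (M := `|M|)) => //; exact: fin_itv.
have aebad : {ae leb, forall x, Omega x ->
    smooth_residual n x @[n --> \oo] --> residual lambda K X x}.
  exists [set 0]; split => //; first exact: lebesgue_measure_set1.
  move=> x /= xbad; apply: contrapT => x0; apply: xbad => Ox.
  by apply: cvg_smooth_residual => //; exact/eqP.
(* The bound on [phi_] is the bound on its derivative times the length [2 * L] of [Omega]. *)
apply: (@distributional_derivative_lim R L (2 * K + 4 * lambda * L)
  ((2 * K + 4 * lambda * L) * (2 * L)) w _ _ phi_) => //.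
- by move=> n; case: (phiP n).
- by move=> n x Ox; case: (phiP n) => _ ->; exact: smooth_residual_bound.
- move=> n x Ox; rewrite phiE//.
  have isr : leb.-integrable `]- L, x[%classic (EFin \o smooth_residual n).
    apply: (@finite_bounded_integrable _ mR _ leb _ _ (2 * K + 4 * lambda * L)).
    + exact: mitv.
    + exact: fin_itv.
    + by apply: measurable_funTS; exact: msr.
    + by move=> y /(subO _ Ox); exact: smooth_residual_bound.
  rewrite (le_trans (le_normr_Rintegral (mitv x) isr))//.
  apply: (@le_trans _ _ (Rintegral leb `]- L, x[ (cst (2 * K + 4 * lambda * L)))).
    apply: le_Rintegral; [exact: mitv|exact: integrable_norm|exact: icst|].
    by move=> y /(subO _ Ox); exact: smooth_residual_bound.
  rewrite Rintegral_cst// ler_wpM2l//.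
    by rewrite addr_ge0 ?mulr_ge0// ltW.
  move: Ox; rewrite /Omega/= in_itv/= => /andP[Lx xL].
  by rewrite lebesgue_measure_itv/= lte_fin Lx/=; lra.
- by apply: measurable_funTS; exact: measurable_residual.
- apply: filterS aebad; first exact: (ae_filter_ringOfSetsType leb).
  move=> x /[apply]; rewrite (_ : (fun n => derive1 _ _) = smooth_residual ^~ x)//.
  by apply/funext => n; case: (phiP n) => _ ->.
- move=> x Ox; rewrite (_ : (fun n => phi_ n x) =
      (fun n => Rintegral leb `]- L, x[ (smooth_residual n))); last first.
    by apply/funext => n; rewrite phiE.
  move: (Ox); rewrite /Omega/= in_itv/= => /andP[/ltW Lx /ltW xL].
  rewrite -Rintegral_residual//.
  apply: (@cvg_Rintegral _ mR R leb _ _ _ (cst (2 * K + 4 * lambda * L))) => //.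
  + by move=> n; apply: measurable_funTS; exact: msr.
  + by apply: measurable_funTS; exact: measurable_residual.
  + apply: filterS aebad; first exact: (ae_filter_ringOfSetsType leb).
    by move=> y h /(subO _ Ox).
  + by move=> n y /(subO _ Ox); exact: smooth_residual_bound.
Qed.

End calibration.

(** * Optimality *)

Section optimality.
Context {R : realType}.
Local Notation mR := (measurableTypeR R).
Local Notation leb := (@lebesgue_measure R).

Lemma Du_distributional_derivative (Omega : set R) (u : R -> R) :
  BV Omega u -> is_distributional_derivative Omega u (Du Omega u).
Proof.
by rewrite /Du => -[_ exnu]; case: pselect => // h; case: (cid h).
Qed.

Variables (L lambda K X M : R) (alpha : R -> R).
Hypotheses (lambda_ge0 : 0 <= lambda) (K_ge0 : 0 <= K).
Hypotheses (X_ge0 : 0 <= X) (X_lt : X < L).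
Let Omega : set R := `]- L, L[%classic.
Let f (x : R) := lambda * x.
Let u := candidate lambda K X.
Let h := residual lambda K X.
Let V := potential L lambda K X.

Hypothesis malpha : measurable_fun setT alpha.
Hypothesis V_le_alpha : forall x, Omega x -> `|V x| <= alpha x <= M.
(** The factor [K] accommodates the regime without jump, where [V 0] may lie strictly below
    [alpha 0]. *)
Hypothesis V_eq_alpha0 : K * V 0 = K * alpha 0.
Hypothesis V_eq_alpha : forall x, - X < x < X -> V x = alpha x.

Let mO : measurable (Omega : set mR). Proof. exact: measurable_itv. Qed.

Let O0 : Omega 0.
Proof.
by rewrite /Omega/= in_itv/= oppr_lt0 andbb (le_lt_trans X_ge0).
Qed.

Let XO : `]- X, X[%classic `<=` Omega.
Proof.
move=> x; rewrite /Omega/= !in_itv/= => /andP[Xx xX].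
by rewrite (lt_trans _ Xx) ?ltrN2// (lt_trans xX).
Qed.

Let iu : leb.-integrable Omega (EFin \o u).
Proof.
apply: (@integrable_Omega _ _ _ (K + 2 * lambda * L)).
  exact: measurable_candidate.
by move=> x; exact: candidate_bound.
Qed.

Let mV : measurable_fun Omega V.
Proof.
have cabs : measurable_fun setT (fun x : R => `|x|) by exact: normr_measurable.
apply: measurable_funTS; apply: measurable_funB.
  by apply: measurable_funB => //; apply: measurable_funM => //; exact: measurable_funB.
apply: measurable_funM => //; apply: measurable_funM => //.
by apply: measurable_funX; apply: measurable_maxr => //; exact: measurable_funB.
Qed.

Let alpha_bounds x : Omega x -> 0 <= alpha x <= M.
Proof.
move=> /V_le_alpha /andP[Va ->]; rewrite andbT; exact: le_trans Va.
Qed.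

Let BVu : BV Omega u.
Proof.
split; first exact: iu.
exists (jump_slope_charge lambda K X).
exact: candidate_distributional_derivative.
Qed.

(** [Du] selects some derivative by choice; uniqueness identifies it with the explicit one. *)
Let DuE A : measurable A -> Du Omega u A = jump_slope_charge lambda K X A.
Proof.
apply: (distributional_derivative_unique (L := L) (u := u)).
  exact: Du_distributional_derivative.
exact: candidate_distributional_derivative.
Qed.

(** The charge lives on the atom 0, of mass [2 * K], and on []- X, X[], where [V] and [alpha] agree
    as required. *)
Let charge_integral_Du : charge_integral (Du Omega u) Omega alpha =
  charge_integral (Du Omega u) Omega V.
Proof.
rewrite !(charge_integral_jump_slope (X := X) (M := M) lambda_ge0 K_ge0 DuE)//.
- rewrite -!mulrA -V_eq_alpha0; congr (_ + _ * _).
  apply/esym/eq_Rintegral => x; rewrite inE/= in_itv; exact: V_eq_alpha.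
- by move=> x /V_le_alpha /andP[]; exact: le_trans.
- exact: measurable_funTS.
- by move=> x /alpha_bounds /andP[a0 ?]; rewrite ger0_norm.
Qed.

Let TV_candidate :
  (\int[variation_measure (Du Omega u)]_(x in Omega) (alpha x)%:E =
   (charge_integral (Du Omega u) Omega V)%:E)%E.
Proof.
rewrite (ge0_charge_integral_variation mO _ alpha_bounds).
- by rewrite charge_integral_Du.
- exact: measurable_funTS.
- by move=> A mA; rewrite DuE//; exact: jump_slope_charge_ge0.
Qed.

Let residual_integrable (v : R -> R) : leb.-integrable Omega (EFin \o v) ->
  leb.-integrable Omega (EFin \o (fun x => v x * h x)).
Proof.
move=> iv; have mv : measurable_fun Omega v.
  by apply/measurable_EFinP; exact: measurable_int iv.
have ikv : leb.-integrable Omega (EFin \o (fun x => (K + lambda * L) * `|v x|)).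
  exact: (integrableZl mO (K + lambda * L) (integrable_norm iv)).
apply: (le_integrable mO _ _ ikv).
  apply/measurable_EFinP; apply: measurable_funM => //.
  by apply: measurable_funTS; exact: measurable_residual.
move=> x Ox /=; rewrite lee_fin normrM mulrC [leRHS]ger0_norm; last first.
  by rewrite mulr_ge0// addr_ge0// mulr_ge0// ltW// (le_lt_trans X_ge0).
by rewrite ler_wpM2r//; exact: residual_bound.
Qed.

Let ihh : leb.-integrable Omega (EFin \o (fun x => h x * h x)).
Proof.
apply: residual_integrable; apply: (integrable_Omega _ (M := K + lambda * L)).
  exact: measurable_residual.
by move=> x; exact: residual_bound.
Qed.

Let fit_candidateE : (\int[leb]_(x in Omega) ((f x - u x) ^+ 2)%:E =
  (Rintegral leb Omega (fun x => h x * h x))%:E)%E.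
Proof.
rewrite /Rintegral fineK; last exact: integrable_fin_num.
apply: eq_integral => x _; congr EFin.
by rewrite /u /candidate /f -/(h x); ring.
Qed.

Lemma candidate_energyE : weighted_TV_energy Omega f alpha u =
  (2^-1 * Rintegral leb Omega (fun x => h x * h x)
   + charge_integral (Du Omega u) Omega V)%:E.
Proof. by rewrite /weighted_TV_energy fit_candidateE TV_candidate. Qed.

Lemma energy_gap w : BV Omega w ->
  (weighted_TV_energy Omega f alpha u
   + (2^-1)%:E * \int[leb]_(x in Omega) ((w x - u x) ^+ 2)%:E
   <= weighted_TV_energy Omega f alpha w)%E.
Proof.
move=> BVw; have [iw _] := BVw.
have mw : measurable_fun Omega w.
  by apply/measurable_EFinP; exact: measurable_int iw.
have msq : measurable_fun Omega (fun x => (f x - w x) ^+ 2).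
  apply: measurable_funX; apply: measurable_funB => //.
  by apply: measurable_funM.
have TVw := charge_integral_le_variation (Du Omega w) mO mV
  (measurable_funTS malpha) V_le_alpha.
have TV0 : (0 <= \int[variation_measure (Du Omega w)]_(x in Omega) (alpha x)%:E)%E.
  by apply: integral_ge0 => x /alpha_bounds /andP[a0 _]; rewrite lee_fin.
have sq0 : (0 <= \int[leb]_(x in Omega) ((f x - w x) ^+ 2)%:E)%E.
  by apply: integral_ge0 => x _; rewrite lee_fin sqr_ge0.
(* Membership in [BV] gives only integrability of [w]; if [f - w] is not square integrable, the
   energy of [w] is infinite. *)
have [fin|] := boolP (\int[leb]_(x in Omega) ((f x - w x) ^+ 2)%:E < +oo)%E; last first.
  rewrite -leNgt leye_eq => /eqP infty; rewrite [leRHS]/weighted_TV_energy infty.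
  by rewrite gt0_muley ?lte_fin// addye ?leey// gt_eqF// (lt_le_trans _ TV0).
have isq : leb.-integrable Omega (EFin \o (fun x => (f x - w x) ^+ 2)).
  apply/integrableP; split; first exact/measurable_EFinP.
  under eq_integral => x _ do rewrite /= ger0_norm ?sqr_ge0//.
  exact: fin.
have iwh := residual_integrable iw; have iuh := residual_integrable iu.
have Lw : Rintegral leb Omega (fun x => w x * h x) =
    - charge_integral (Du Omega w) Omega V :=
  calibration_identity lambda_ge0 K_ge0 X_ge0 X_lt iw
    (Du_distributional_derivative BVw).
have Lu : Rintegral leb Omega (fun x => u x * h x) =
    - charge_integral (Du Omega u) Omega V :=
  calibration_identity lambda_ge0 K_ge0 X_ge0 X_lt iu
    (Du_distributional_derivative BVu).
pose I := Rintegral leb Omega (fun x => (f x - w x) ^+ 2).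
(* Pointwise, [f = u - h] gives (w - u)^2 = (f - w)^2 - 2wh + 2uh - h^2. *)
have gapE : (\int[leb]_(x in Omega) ((w x - u x) ^+ 2)%:E)%E =
    (I - 2 * Rintegral leb Omega (fun x => w x * h x)
       + 2 * Rintegral leb Omega (fun x => u x * h x)
       - Rintegral leb Omega (fun x => h x * h x))%:E.
  have i1 := integrableZl mO 2 iwh.
  have i2 := integrableZl mO 2 iuh.
  have i3 := integrableB mO isq i1.
  have i4 := integrableD mO i3 i2.
  rewrite -!RintegralZl// -RintegralB// -RintegralD// -RintegralB//.
  rewrite /Rintegral fineK; last first.
    by apply: integrable_fin_num => //; exact: (integrableB mO i4 ihh).
  apply: eq_integral => x _; congr EFin.
  by rewrite /u /candidate /f -/(h x); ring.
have IE : (\int[leb]_(x in Omega) ((f x - w x) ^+ 2)%:E)%E = I%:E.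
  by rewrite /I /Rintegral fineK// ge0_fin_numE.
rewrite candidate_energyE gapE Lw Lu -EFinM -EFinD [leRHS]/weighted_TV_energy IE.
(* This is the only inequality: once the weighted variation of [w] is bounded below, both sides are
   equal. *)
apply: le_trans (leeD2l _ TVw); rewrite -EFinM -EFinD lee_fin.
rewrite le_eqVlt; apply/orP; left; apply/eqP.
clearbody I; move: (charge_integral (Du Omega w) Omega V).
move: (charge_integral (Du Omega u) Omega V).
by move: (Rintegral leb Omega (fun x => h x * h x)) => p q r; field.
Qed.

Lemma candidate_is_the_solution : is_the_solution Omega f alpha u.
Proof.
have gap0 w : (0 <= (2^-1)%:E * \int[leb]_(x in Omega) ((w x - u x) ^+ 2)%:E)%E.
  rewrite mule_ge0 ?lee_fin ?invr_ge0//.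
  by apply: integral_ge0 => x _; rewrite lee_fin sqr_ge0.
split; first split; first exact: BVu.
  by move=> w BVw; apply: le_trans (energy_gap BVw); rewrite leeDl.
move=> w [BVw /(_ u BVu) Ewu].
have [iw _] := BVw.
have mw : measurable_fun Omega w.
  by apply/measurable_EFinP; exact: measurable_int iw.
pose g x := ((w x - u x) ^+ 2)%:E.
have msq : measurable_fun Omega g.
  apply/measurable_EFinP; apply: measurable_funX; apply: measurable_funB => //.
  by apply: measurable_funTS; exact: measurable_candidate.
have : (\int[leb]_(x in Omega) ((w x - u x) ^+ 2)%:E = 0)%E.
  have := le_trans (energy_gap BVw) Ewu.
  (* The energy of [u] is a real number, so it cancels. *)
  rewrite candidate_energyE -[leRHS]adde0 leeD2lE// => le0.
  have /eqP : ((2^-1)%:E * \int[leb]_(x in Omega) ((w x - u x) ^+ 2)%:E = 0)%E.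
    by apply/eqP; rewrite eq_le le0 gap0.
  by rewrite mule_eq0 eqe invr_eq0 pnatr_eq0/= => /eqP.
have absE : (\int[leb]_(x in Omega) `|g x|)%E =
    (\int[leb]_(x in Omega) ((w x - u x) ^+ 2)%:E)%E.
  by apply: eq_integral => x _; rewrite /g /= ger0_norm ?sqr_ge0.
rewrite -absE => /(ae_eq_integral_abs leb mO msq) aeg.
have {}aeg : {ae leb, forall x, Omega x -> g x = 0%E} by exact: aeg.
apply: filterS aeg; first exact: (ae_filter_ringOfSetsType leb).
move=> x /[apply] -[] /eqP.
by rewrite sqrf_eq0 subr_eq0 => /eqP.
Qed.

End optimality.

(** * The three regimes *)

Theorem proposition3p13 (R : realType) (L lambda mu c : R)
    (L_gt0 : 0 < L) (lambda_gt0 : 0 < lambda) (mu_gt0 : 0 < mu)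
    (c_gt0 : 0 < c) :
  let Omega : set R := [set` `]- L, L[] in
  let f : R -> R := fun x => lambda * x in
  let alpha : R -> R := fun x => mu * `|x| + c in
  (mu * L + c < lambda * L ^+ 2 / 2 ->
     let xmc := L - Num.sqrt (2 * lambda * mu * L + 2 * lambda * c) / lambda in
     is_the_solution Omega f alpha (fun x =>
       if x <= - xmc then - lambda * xmc - mu
       else if x < 0 then lambda * x - mu
       else if x < xmc then lambda * x + mu
       else lambda * xmc + mu)) /\
  (mu * L + c >= lambda * L ^+ 2 / 2 -> c < lambda * L ^+ 2 / 2 ->
     is_the_solution Omega f alpha (fun x =>
       if x < 0 then - (lambda * L / 2) + c / L
       else lambda * L / 2 - c / L)) /\
  (c >= lambda * L ^+ 2 / 2 ->
     is_the_solution Omega f alpha (fun=> 0)).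
Proof.
move=> Omega f alpha.
have l0 := ltW lambda_gt0.
have malpha : measurable_fun setT alpha.
  have mabs : measurable_fun setT (fun x : R => `|x|) by exact: normr_measurable.
  by apply: measurable_funD => //; exact: measurable_funM.
have alpha_ge0 y : 0 <= y -> 0 <= mu * y + c.
  by move=> y0; rewrite addr_ge0 ?(ltW c_gt0)// mulr_ge0// ltW.
(* The potentials are even, so the bound by [alpha] is checked on [[0, L[] only. *)
have bound V : (forall y, 0 <= y < L -> `|V y| <= mu * y + c) ->
    (forall x, V `|x| = V x) ->
    forall x, Omega x -> `|V x| <= alpha x <= mu * L + c.
  move=> HV Vabs x; rewrite /Omega/= in_itv/= -ltr_norml => xL.
  by rewrite -Vabs HV ?normr_ge0//= lerD2r ler_pM2l// ltW.
have pot_abs K X x : potential L lambda K X `|x| = potential L lambda K X x.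
  by rewrite /potential normr_id.
have pot_in K X y : 0 <= y -> y <= X ->
    potential L lambda K X y = lambda * (L - X) ^+ 2 / 2 - K * (L - y).
  move=> y0 yX; rewrite /potential ger0_norm// (elimT max_idPl) ?subr_le0//.
  by rewrite expr0n/= mulr0 mul0r subr0.
have pot_out K X y : 0 <= y -> X <= y ->
    potential L lambda K X y =
    lambda * (L - X) ^+ 2 / 2 - K * (L - y) - lambda * (y - X) ^+ 2 / 2.
  by move=> y0 Xy; rewrite /potential ger0_norm// (elimT max_idPr) ?subr_ge0.
split=> [small xmc|]; last split=> [large cL|cL].
- pose S := Num.sqrt (2 * lambda * mu * L + 2 * lambda * c).
  have S2 : S ^+ 2 = 2 * lambda * (mu * L + c).
    by rewrite sqr_sqrtr; [ring|rewrite addr_ge0// !mulr_ge0// ltW].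
  have mLc : 0 < mu * L + c by rewrite addr_gt0// mulr_gt0.
  have S0 : 0 < S by rewrite sqrtr_gt0 addr_gt0// !mulr_gt0.
  have SL : S < lambda * L.
    rewrite -(ltr_pXn2r (n := 2))// ?nnegrE ?mulr_ge0 ?ltW//.
    by rewrite S2; nra.
  have X0 : 0 < xmc by rewrite subr_gt0 ltr_pdivrMr// [ltRHS]mulrC.
  have XL : xmc < L by rewrite ltrBlDr ltrDl divr_gt0.
  (* The choice of [xmc] makes [lambda (L - xmc) ^ 2 / 2 = mu L + c]. *)
  have XE : lambda * (L - xmc) ^+ 2 / 2 = mu * L + c.
    rewrite /xmc subKr expr_div_n S2; by field; rewrite gt_eqF.
  clearbody xmc.
  (* After multiplication by [L - xmc], this follows from [mu * (L - xmc) <= mu * L + c]. *)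
  have mu_le : 2 * mu <= lambda * (L - xmc).
    have LX : 0 < L - xmc by rewrite subr_gt0.
    have e : lambda * (L - xmc) * (L - xmc) = 2 * (mu * L + c).
      by rewrite -XE; field.
    rewrite -(ler_pM2r LX) e.
    by have : 0 <= mu * xmc by [rewrite mulr_ge0 ?ltW]; lra.
  rewrite (_ : (fun x => _) = candidate lambda mu xmc); last first.
    apply/funext => x; rewrite /candidate /residual.
    (* At [x = - xmc] the two definitions take different branches, whose values coincide. *)
    case: (ltgtP x (- xmc)) => [_|_|->].
    + by ring.
    + by case: ifP => _; [ring|case: ifP => _; ring].
    + by rewrite ifT; [ring|rewrite oppr_lt0].
  apply: (candidate_is_the_solution (M := mu * L + c) l0 (ltW mu_gt0) (ltW X0)
    XL malpha).
  + apply: bound => [y /andP[y0 yL]|x]; last by rewrite pot_abs.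
    have [yX|/ltW Xy] := leP y xmc.
      rewrite pot_in// XE (_ : _ - _ = mu * y + c); last by ring.
      by rewrite ger0_norm// alpha_ge0.
    rewrite pot_out// ler_norml; apply/andP; split.
      (* The second factor is nonnegative by [mu_le] and [xmc <= y], so the potential is
         nonnegative. *)
      rewrite (_ : _ - _ - _ = (L - y) * (lambda * (L + y) / 2 - lambda * xmc - mu)).
        rewrite (@le_trans _ _ 0)//.
          by rewrite oppr_le0 alpha_ge0.
        have ly : 0 <= lambda * (y - xmc) by rewrite mulr_ge0// subr_ge0.
        by rewrite mulr_ge0 ?subr_ge0 ?(ltW yL)//; lra.
      by field.
    rewrite XE; have : 0 <= lambda * (y - xmc) ^+ 2 by rewrite mulr_ge0// sqr_ge0.
    by move=> h; nra.
  + by rewrite (pot_in _ _ _ (lexx 0) (ltW X0)) XE /alpha normr0; ring.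
  + move=> x; rewrite -ltr_norml => /ltW xX.
    by rewrite -pot_abs pot_in// XE /alpha; ring.
(* This height makes the potential at 0 equal to [c], that is, to [alpha 0]. *)
- pose K := lambda * L / 2 - c / L.
  have KL : K * L = lambda * L ^+ 2 / 2 - c by rewrite /K; field; rewrite gt_eqF.
  have K0 : 0 <= K by rewrite -(ler_pM2r L_gt0) KL mul0r subr_ge0 ltW.
  (* The potential on [[0, L[] is c + K y - lambda y^2 / 2, so [K <= mu] puts it below [alpha]. *)
  have Kmu : K <= mu by rewrite -(ler_pM2r L_gt0) KL lerBlDr.
  rewrite (_ : (fun x => _) = candidate lambda K 0); last first.
    apply/funext => x; rewrite /candidate /residual oppr0.
    by case: ltP => _; rewrite /K; field; rewrite gt_eqF.
  apply: (candidate_is_the_solution (M := mu * L + c) l0 K0 (lexx 0) L_gt0 malpha).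
  + apply: bound => [y /andP[y0 yL]|x]; last by rewrite pot_abs.
    (* This factorization shows that the potential is nonnegative. *)
    have potE : potential L lambda K 0 y = (L - y) * (lambda * y / 2 + c / L).
      by rewrite pot_out// /K; field; rewrite gt_eqF.
    have cL0 : 0 <= c / L by rewrite divr_ge0 ?ltW.
    rewrite potE ger0_norm; last first.
      by rewrite mulr_ge0 ?subr_ge0 ?(ltW yL)// addr_ge0// divr_ge0// mulr_ge0.
    rewrite -potE pot_out//.
    clearbody K.
    have h1 : 0 <= (mu - K) * y by rewrite mulr_ge0// subr_ge0.
    have h2 : 0 <= lambda * y ^+ 2 by rewrite mulr_ge0// sqr_ge0.
    by lra.
  + by rewrite pot_out ?lexx// /alpha normr0 /K; field; rewrite gt_eqF.
  + by move=> x /andP[]; rewrite oppr0 => /lt_trans /[apply]; rewrite ltxx.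
- rewrite (_ : (fun x => _) = candidate lambda 0 0); last first.
    apply/funext => x; rewrite /candidate /residual oppr0.
    by case: ltP => _; ring.
  apply: (candidate_is_the_solution (M := mu * L + c) l0 (lexx 0) (lexx 0) L_gt0 malpha).
  + apply: bound => [y /andP[y0 yL]|x]; last by rewrite pot_abs.
    (* The potential is now lambda (L^2 - y^2) / 2, which is at most lambda L^2 / 2 and hence at
       most [c]. *)
    rewrite pot_out// !subr0 mul0r subr0 ger0_norm; last first.
      rewrite subr_ge0 ler_pM2r ?invr_gt0// ler_wpM2l//.
      by rewrite lerXn2r ?nnegrE// ltW.
    have h1 : 0 <= mu * y by rewrite mulr_ge0// ltW.
    have h2 : 0 <= lambda * y ^+ 2 by rewrite mulr_ge0// sqr_ge0.
    by lra.
  + by rewrite !mul0r.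
  + by move=> x /andP[]; rewrite oppr0 => /lt_trans /[apply]; rewrite ltxx.
Qed.
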